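(* Let $\epsilon > 0$, $X > 1$ and let $H$ be a real number with $X^{3\epsilon} \le H \le X^{1/2-\epsilon}$. For each $x$ put $y = y(x) = 2\sqrt{x}\,H + H^2$ (so that $\sqrt{x+y} - \sqrt{x} = H$). Then $$\frac{1}{X} \int_{X}^{2X} \Big| Q(x+y) - Q(x) - \frac{\zeta(3/2)}{\zeta(3)} H \Big|^2 dx \ll_\epsilon H^{16/11+\epsilon}.$$
   Context: A positive integer $n$ is squarefull if $p^2 \mid n$ for every prime $p \mid n$ (so $1$ is squarefull). $Q(x)$ denotes the number of squarefull positive integers $n \le x$; equivalently $Q(x) = \sum_{a^2b^3 \le x} \mu^2(b)$, the sum being over positive integers $a, b$, with $\mu$ the Möbius function. $\zeta$ is the Riemann zeta function. The notation $f \ll_\epsilon g$ means $|f| \le C g$ for a constant $C > 0$ depending only on $\epsilon$. *)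

(* Defs.v *)
From mathcomp Require Import all_boot all_order all_algebra.
From mathcomp Require Import all_classical all_reals all_analysis.
Set Implicit Arguments.
Unset Strict Implicit.
Unset Printing Implicit Defensive.
Import Order.TTheory GRing.Theory Num.Theory.
Import numFieldNormedType.Exports.
Local Open Scope ring_scope.

(* [primes n] lists the primes dividing [n]; it is empty for [n = 0], hence the
   explicit positivity condition. *)
Definition squarefull (n : nat) : bool :=
  (0 < n)%N && all (fun p => (p ^ 2 %| n)%N) (primes n).

Lemma squarefullP (n : nat) :
  reflect ((0 < n)%N /\ forall p, prime p -> (p %| n)%N -> (p ^ 2 %| n)%N)
          (squarefull n).
Proof.
apply: (iffP andP) => -[n_gt0 sqn]; split=> //.
  by move=> p pp pn; apply: (allP sqn); rewrite mem_primes pp n_gt0.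
by apply/allP => p; rewrite mem_primes => /and3P[pp _]; exact: sqn.
Qed.

(* For [x < 0] one has [Num.truncn x = 0], and the count is [0]. *)
Definition squarefull_count {R : realType} (x : R) : nat :=
  count squarefull (iota 1 (Num.truncn x)).

(* The Dirichlet series of the Riemann zeta function at a real argument
   [s > 1]; the value is meaningless for [s <= 1], where the series diverges. *)
Definition zeta {R : realType} (s : R) : R :=
  limn (series (fun n => (n.+1%:R `^ s)^-1)).

(* For [0 <= x] and [0 <= H] this is the [y] with
   [Num.sqrt (x + y) - Num.sqrt x = H]. *)
Definition interval_length {R : realType} (H x : R) : R :=
  2 * Num.sqrt x * H + H ^+ 2.

(* Main.v *)
Require Import Defs.
From mathcomp Require Import all_boot all_order all_algebra.
From mathcomp Require Import all_classical all_reals all_analysis.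
From mathcomp Require Import measurable_realfun ring lra.
Set Implicit Arguments.
Unset Strict Implicit.
Unset Printing Implicit Defensive.
Import Order.TTheory GRing.Theory Num.Theory.
Import numFieldNormedType.Exports.
Local Open Scope classical_set_scope.
Local Open Scope ring_scope.

(** Every squarefull number is uniquely [a ^ 2 * b ^ 3] with [b] squarefree
    ([squarefull_decomp], [squarefull_form_inj]), so the squarefull numbers in
    [(x, x + y]] are counted by the pairs with
    [sqrt x < a * b ^ (3 / 2) <= sqrt x + H]. For a fixed [b] the number of
    such [a] is a difference of two integer parts, hence within [1] of
    [H / b ^ (3 / 2)]; and the sum of [1 / b ^ (3 / 2)] over squarefree [b] is
    [zeta (3 / 2) / zeta 3], because every positive integer is uniquely
    [b * m ^ 2].

    Cut the sum over [b] at [z], with [z ^ 3] of the order of [H ^ 2]. The terms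
    [b < z] deviate from their main terms by at most [z] in all, and the main
    terms that are missing, those with [z <= b], add up to
    [O(H / sqrt z) = O(z)] ([deviation_le]). It remains to bound the mean square
    of the number of [a ^ 2 * b ^ 3] in [(x, x + y]] with [z <= b], for which
    the expected order of magnitude suffices. Since [y <= D] with [D = 4 * sqrt X * H], split
    [b] into dyadic blocks [B <= b < 2 * B], expand the square and integrate: the
    question becomes how many quadruples satisfy
    [|a ^ 2 * b ^ 3 - a' ^ 2 * b' ^ 3| <= D], where [a] and [a'] are of size
    [A = sqrt (6 * X / B ^ 3)].

    This condition says that the fractions [(a / a') ^ 2] and [(b' / b) ^ 3]
    differ by [O(D / X)]. Fractions with a prescribed common factor of numerator
    and denominator are well spaced ([frac_spacing]), so when [a], [a'] are
    fixed there are few admissible [b], [b'], and conversely; taking the better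
    of the two bounds for each pair of common factors ([card_two_fibres]) and
    summing over them gives [O(log X ^ 2 * (A * B + D / X * (A * B) ^ 2))]
    quadruples ([card_close]), the second term being the expected number.

    With [(A * B) ^ 2 = 6 * X / B] and [z <= B] the whole mean square is
    [O(log X ^ 4 * z ^ 2)] ([variance_le]), that is
    [O(log X ^ 4 * H ^ (4 / 3))]. As [H] is at least a fixed power of [X], the
    logarithms are [O(H ^ eps)], and [4 / 3 < 16 / 11]. *)

(** * Squarefree part and the shape of squarefull numbers *)

Definition squarefree (n : nat) : bool :=
  (0 < n)%N && [forall d : 'I_n.+1, (d ^ 2 %| n)%N ==> (d == 1%N :> nat)].

Lemma squarefree_gt0 n : squarefree n -> (0 < n)%N.
Proof. by case/andP. Qed.

Lemma squarefree_sqr_dvd n d : squarefree n -> (d ^ 2 %| n)%N -> d = 1%N.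
Proof.
move=> /andP[n0 /forallP sq] dn.
have dltn : (d < n.+1)%N.
  rewrite ltnS; apply: leq_trans (dvdn_leq n0 dn).
  by rewrite -mulnn; case: (d) => // e; rewrite leq_pmulr.
by have /implyP/(_ dn)/eqP := sq (Ordinal dltn).
Qed.

Lemma squarefreeP n :
  (0 < n)%N -> (forall d, (d ^ 2 %| n)%N -> d = 1%N) -> squarefree n.
Proof.
move=> n0 sq; rewrite /squarefree n0; apply/forallP => d.
by apply/implyP => /sq ->.
Qed.

Lemma squarefree_part n : (0 < n)%N ->
  exists b m, [/\ squarefree b, (0 < m)%N & n = (b * m ^ 2)%N].
Proof.
move=> n0.
have ex1 : exists d, (0 < d)%N && (d ^ 2 %| n)%N by exists 1%N; rewrite dvd1n.
have bnd d : (0 < d)%N && (d ^ 2 %| n)%N -> (d <= n)%N.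
  move=> /andP[d0 /(dvdn_leq n0)]; apply: leq_trans.
  by rewrite -mulnn leq_pmulr.
case: (ex_maxnP ex1 bnd) => m /andP[m0 mn] mmax.
exists (n %/ m ^ 2)%N, m; split=> //; last by rewrite divnK.
apply: squarefreeP => [|d dn].
  by rewrite divn_gt0 ?expn_gt0 ?m0// dvdn_leq.
have dm : ((d * m) ^ 2 %| n)%N.
  by rewrite expnMn -(divnK mn) dvdn_pmul2r ?expn_gt0 ?m0.
have d0 : (0 < d)%N.
  case: (posnP d) dm => // -> /=; rewrite mul0n exp0n// dvd0n => /eqP n0'.
  by rewrite n0' in n0.
have := mmax (d * m)%N; rewrite muln_gt0 d0 m0 dm => /(_ isT) dmm.
by apply/eqP; rewrite eqn_leq d0 andbT -(leq_pmul2r m0) mul1n.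
Qed.

(** After division by the common factor of [m] and [m'], the square of each
    cofactor divides the opposite squarefree part, hence is trivial. *)
Lemma squarefree_part_inj b m b' m' :
  squarefree b -> squarefree b' -> (0 < m)%N -> (0 < m')%N ->
  (b * m ^ 2 = b' * m' ^ 2)%N -> b = b' /\ m = m'.
Proof.
move=> sb sb' m0 m0' E.
have g0 : (0 < gcdn m m')%N by rewrite gcdn_gt0 m0.
have [s Es] := dvdnP (dvdn_gcdl m m'); have [t Et] := dvdnP (dvdn_gcdr m m').
have cst : coprime s t.
  rewrite /coprime -(eqn_pmul2r g0) mul1n muln_gcdl -Es -Et.
  exact: eqxx.
move: (gcdn m m') g0 Es Et => g g0 Es Et.
have E2 : (b * s ^ 2 = b' * t ^ 2)%N.
  apply/eqP; rewrite -(eqn_pmul2r (_ : 0 < g ^ 2)%N) ?expn_gt0 ?g0//.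
  have -> : (b * s ^ 2 * g ^ 2 = b * m ^ 2)%N by rewrite Es; ring.
  by rewrite E Et; apply/eqP; ring.
have s1 : s = 1%N.
  apply: (squarefree_sqr_dvd sb').
  by rewrite -(@Gauss_dvdl _ _ (t ^ 2)) ?coprimeXl ?coprimeXr// -E2 dvdn_mull.
have t1 : t = 1%N.
  apply: (squarefree_sqr_dvd sb).
  by rewrite -(@Gauss_dvdl _ _ (s ^ 2)) ?coprimeXl ?coprimeXr// 1?coprime_sym// E2 dvdn_mull.
by move: E2; rewrite s1 t1 !muln1 => ->; rewrite Es Et s1 t1.
Qed.

Lemma squarefull_form a b : (0 < a)%N -> (0 < b)%N -> squarefull (a ^ 2 * b ^ 3).
Proof.
move=> a0 b0; apply/squarefullP; split=> [|p pp].
  by rewrite muln_gt0 !expn_gt0 a0 b0.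
rewrite (Euclid_dvdM _ _ pp) !(Euclid_dvdX _ _ pp) !andbT => /orP[] pd.
  by apply/dvdn_mulr/dvdn_exp2r.
by apply: dvdn_mull; rewrite [(b ^ 3)%N]expnSr; apply/dvdn_mulr/dvdn_exp2r.
Qed.

(** In [n = b * m ^ 2] with [b] squarefree, a prime dividing [b] but not [m]
    would divide [n] exactly once. Hence [b] divides [m]. *)
Lemma squarefull_decomp n : squarefull n ->
  exists a b, [/\ (0 < a)%N, squarefree b & n = (a ^ 2 * b ^ 3)%N].
Proof.
move=> /squarefullP[n0 sqn].
have [b [m [sb m0 En]]] := squarefree_part n0.
have b0 := squarefree_gt0 sb.
suff /dvdnP[a Ea] : (b %| m)%N.
  exists a, b; split=> //; first by case: (posnP a) Ea m0 => // -> ->.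
  by rewrite En Ea; ring.
have [s Es] := dvdnP (dvdn_gcdl b m).
suff s1 : s = 1%N by rewrite [X in (X %| m)%N]Es s1 mul1n dvdn_gcdr.
apply/eqP; apply: contraT => s_neq1.
have s_gt1 : (1 < s)%N.
  by move: Es s_neq1 b0; case: (s) => [|[|]]// ->.
have pp := pdiv_prime s_gt1; set p := pdiv s in pp.
have ps : (p %| s)%N := pdiv_dvd s.
have pb : (p %| b)%N by rewrite Es dvdn_mulr.
have p2n : (p ^ 2 %| n)%N by apply: sqn => //; rewrite En dvdn_mulr.
have npm : ~~ (p %| m)%N.
  apply/negP => pm.
  have : p = 1%N; last by move=> p1; rewrite p1 in pp.
  apply: (squarefree_sqr_dvd sb); rewrite Es -mulnn dvdn_mul//.
  by rewrite dvdn_gcd pb pm.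
have : p = 1%N; last by move=> p1; rewrite p1 in pp.
apply: (squarefree_sqr_dvd sb).
rewrite -(@Gauss_dvdl _ _ (m ^ 2)) -?En// coprimeXl// coprimeXr//.
by rewrite prime_coprime.
Qed.

Lemma squarefull_form_inj a b a' b' :
  (0 < a)%N -> (0 < a')%N -> squarefree b -> squarefree b' ->
  (a ^ 2 * b ^ 3 = a' ^ 2 * b' ^ 3)%N -> a = a' /\ b = b'.
Proof.
move=> a0 a0' sb sb' E.
have b0 := squarefree_gt0 sb; have b0' := squarefree_gt0 sb'.
have E' : (b * (a * b) ^ 2 = b' * (a' * b') ^ 2)%N.
  have -> : (b * (a * b) ^ 2 = a ^ 2 * b ^ 3)%N by ring.
  by rewrite E; ring.
have ab0 : (0 < a * b)%N by rewrite muln_gt0 a0.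
have ab0' : (0 < a' * b')%N by rewrite muln_gt0 a0'.
have [<- /eqP] := squarefree_part_inj sb sb' ab0 ab0' E'.
by rewrite eqn_pmul2r// => /eqP.
Qed.

(** * Close pairs of monomials *)

Section spacing.
Variable R : realType.
Implicit Types l L s : R.

(** Cut the interval into pieces of length [s]: no piece holds two points. *)
Lemma card_spaced (I : finType) (P : {pred I}) (f : I -> R) l L s :
  0 < s -> 0 <= L ->
  {in P, forall i, l <= f i <= l + L} ->
  {in P &, forall i j, i != j -> s <= `|f i - f j|} ->
  #|P|%:R <= 1 + L / s.
Proof.
move=> s0 L0 fP sep.
pose c i := Num.truncn ((f i - l) / s).
have c0 i : i \in P -> 0 <= (f i - l) / s.
  by move=> /fP /andP[lf _]; rewrite divr_ge0 ?subr_ge0// ltW.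
have cP i : i \in P -> (c i < (Num.truncn (L / s)).+1)%N.
  move=> iP; rewrite ltnS le_truncn// ler_pM2r ?invr_gt0//.
  by rewrite lerBlDl; case/andP: (fP _ iP).
have inj : {in P &, injective (fun i => inord (c i) : 'I_(Num.truncn (L / s)).+1)}.
  move=> i j iP jP /(congr1 val) /=; rewrite !inordK ?cP// => cij.
  apply/eqP; apply: contraT => ij.
  have := sep i j iP jP ij.
  have /andP[i1 i2] := truncn_itv (c0 i iP).
  have /andP[j1 j2] := truncn_itv (c0 j jP).
  rewrite -/(c i) -/(c j) cij in i1 i2 j1 j2.
  rewrite leNgt; case/negP.
  have -> : f i - f j = ((f i - l) / s - (f j - l) / s) * s by field; lra.
  rewrite normrM (gtr0_norm s0) gtr_pMl// ltr_norml.
  by rewrite -natr1 in i2 j2; apply/andP; split; lra.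
apply: le_trans (_ : ((Num.truncn (L / s)).+1)%:R <= _).
  rewrite ler_nat -(card_in_imset inj).
  by rewrite (leq_trans (max_card _))// card_ord.
rewrite -natr1 addrC lerD2l.
by have /andP[] := truncn_itv (divr_ge0 L0 (ltW s0)).
Qed.

End spacing.

Lemma frac_inj p q p' q' : (0 < p)%N -> (0 < p')%N ->
  gcdn p q = gcdn p' q' -> (p * q' = p' * q)%N -> p = p' /\ q = q'.
Proof.
move=> p0 p0' eg epq.
have E : p = p'.
  have : (p * gcdn p' q' = p' * gcdn p q)%N.
    by rewrite !muln_gcdr epq (mulnC p p').
  by rewrite eg => /eqP; rewrite eqn_pmul2r ?gcdn_gt0 ?p0'// => /eqP.
by split=> //; move/eqP: epq; rewrite -E eqn_pmul2l// => /eqP.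
Qed.

(** Two distinct fractions whose terms have the same greatest common divisor
    [g]: the numerator of their difference is a nonzero multiple of [g ^ 2]. *)
Lemma frac_spacing (R : realType) (g p q p' q' : nat) (Q : R) :
  (0 < g)%N -> (0 < p)%N -> (0 < q)%N -> (0 < p')%N -> (0 < q')%N ->
  gcdn p q = g -> gcdn p' q' = g -> (p, q) != (p', q') ->
  q%:R <= Q -> q'%:R <= Q ->
  (g%:R / Q) ^+ 2 <= `|p%:R / q%:R - p'%:R / q'%:R| :> R.
Proof.
move=> g0 p0 q0 p0' q0' eg eg' neq qQ qQ'.
have Q0 : 0 < Q by apply: lt_le_trans qQ; rewrite ltr0n.
have rq0 : 0 < q%:R :> R by rewrite ltr0n.
have rq0' : 0 < q'%:R :> R by rewrite ltr0n.
have num : g%:R ^+ 2 <= `|p%:R * q'%:R - p'%:R * q%:R| :> R.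
  have ne : (p * q' != p' * q)%N.
    apply: contra neq => /eqP epq.
    by have [|-> ->] := @frac_inj p q p' q' p0 p0' _ epq; rewrite ?eg ?eg'.
  have d1 : (g ^ 2 %| p * q')%N.
    by rewrite -mulnn dvdn_mul// -?eg ?dvdn_gcdl// eg -eg' dvdn_gcdr.
  have d2 : (g ^ 2 %| p' * q)%N.
    by rewrite -mulnn dvdn_mul// -?eg' ?dvdn_gcdl// eg' -eg dvdn_gcdr.
  rewrite -natrX -!natrM.
  wlog le : p q p' q' p0 q0 p0' q0' eg eg' neq qQ qQ' rq0 rq0' ne d1 d2 / (p' * q <= p * q')%N.
    move=> W; have [?|/ltnW ?] := leqP (p' * q) (p * q'); first exact: W.
    by rewrite distrC; apply: W => //; rewrite eq_sym.
  rewrite -natrB// ger0_norm ?ler0n// ler_nat dvdn_leq ?dvdn_sub//.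
  by rewrite subn_gt0 ltn_neqAle eq_sym ne.
have -> : p%:R / q%:R - p'%:R / q'%:R = (p%:R * q'%:R - p'%:R * q%:R) / (q%:R * q'%:R) :> R.
  by field; rewrite !gt_eqF.
rewrite normrM normfV (gtr0_norm (mulr_gt0 rq0 rq0')) expr_div_n.
rewrite ler_pM ?sqr_ge0 ?invr_ge0 ?sqr_ge0//.
by rewrite lef_pV2 ?posrE ?exprn_gt0 ?mulr_gt0// expr2 ler_pM ?ler0n.
Qed.

Lemma card_multiples (R : realType) (K g : nat) (A : R) :
  0 <= A -> (0 < g)%N ->
  #|[pred a : 'I_K | [&& (0 < a)%N, (g %| a)%N & (a%:R <= A)]]|%:R <= A / g%:R.
Proof.
move=> A0 g0; have rg0 : 0 < g%:R :> R by rewrite ltr0n.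
have [Ag|gA] := ltP A g%:R.
  rewrite eq_card0 ?divr_ge0 ?ler0n// => a; rewrite inE.
  apply/negP => /and3P[a0 /(dvdn_leq a0) ga aA].
  by move: Ag; rewrite ltNge (le_trans _ aA)// ler_nat.
have -> : A / g%:R = 1 + (A - g%:R) / g%:R by field; rewrite gt_eqF.
apply: (@card_spaced _ _ _ (fun a : 'I_K => a%:R) g%:R) => //.
- by rewrite subr_ge0.
- move=> a; rewrite inE => /and3P[a0 ga aA].
  by rewrite addrC subrK aA andbT ler_nat dvdn_leq.
move=> a a'; rewrite !inE => /and3P[_ ga _] /and3P[_ ga' _].
wlog le : a a' ga ga' / (a' <= a)%N.
  move=> W; have [?|/ltnW ?] := leqP a' a; first exact: W.
  by rewrite distrC eq_sym; exact: W.
move=> neq; rewrite -natrB// ger0_norm ?ler0n// ler_nat dvdn_leq ?dvdn_sub//.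
by rewrite subn_gt0 ltn_neqAle le andbT eq_sym.
Qed.

Lemma card_gcd_pairs (R : realType) (K g : nat) (A : R) :
  0 <= A -> (0 < g)%N ->
  #|[pred p : 'I_K * 'I_K | [&& (0 < p.1)%N, (0 < p.2)%N, gcdn p.1 p.2 == g,
       (p.1%:R <= A) & (p.2%:R <= A)]]|%:R <= (A / g%:R) ^+ 2.
Proof.
move=> A0 g0.
set M := [pred a : 'I_K | [&& (0 < a)%N, (g %| a)%N & (a%:R <= A)]].
apply: le_trans (_ : #|[predX M & M]|%:R <= _).
  rewrite ler_nat; apply: subset_leq_card; apply/fintype.subsetP => -[a a'].
  rewrite !inE /= => /and5P[a0 a0' /eqP <- aA aA'].
  by rewrite a0 a0' dvdn_gcdl dvdn_gcdr aA aA'.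
rewrite cardX natrM expr2.
by rewrite ler_pM ?ler0n// card_multiples.
Qed.

Lemma card_fibres (R : realType) (U V : finType) (A : {pred U})
    (T : {pred U * V}) (c : R) :
  0 <= c -> (forall t, t \in T -> t.1 \in A) ->
  (forall u, #|[pred v | (u, v) \in T]|%:R <= c) ->
  #|T|%:R <= #|A|%:R * c.
Proof.
move=> c0 TA fib.
have -> : #|T| = (\sum_(u in A) #|[pred v | (u, v) \in T]|)%N.
  rewrite -sum1_card (eq_bigl (fun t : U * V => (t.1 \in A) && ((t.1, t.2) \in T))).
    rewrite -(pair_big_dep (fun u => u \in A) (fun u v => (u, v) \in T) (fun _ _ => 1%N)).
    by apply: eq_bigr => u _; rewrite -sum1_card; apply: eq_bigl => v; rewrite inE.
  move=> [u v] /=; apply/idP/andP => [uv|[]//].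
  by split=> //; exact: (TA _ uv).
rewrite natr_sum (le_trans (ler_sum _ (fun u _ => fib u)))//.
by rewrite sumr_const mulr_natl.
Qed.

(** Counting along either projection gives two bounds, and the smaller one is
    at most [x * y + t * (x * y) ^+ 2] because [min x y ^+ 2 <= x * y]. *)
Lemma card_two_fibres (R : realType) (U V : finType) (A : {pred U})
    (B : {pred V}) (T : {pred U * V}) (x y t : R) :
  0 <= x -> 0 <= y -> 0 <= t ->
  (forall w, w \in T -> w.1 \in A) -> (forall w, w \in T -> w.2 \in B) ->
  #|A|%:R <= x ^+ 2 -> #|B|%:R <= y ^+ 2 ->
  (forall u, #|[pred v | (u, v) \in T]|%:R <= 1 + t * y ^+ 2) ->
  (forall v, #|[pred u | (u, v) \in T]|%:R <= 1 + t * x ^+ 2) ->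
  #|T|%:R <= x * y + t * (x * y) ^+ 2.
Proof.
move=> x0 y0 t0 TA TB cA cB fA fB.
have cx : 0 <= 1 + t * x ^+ 2 by rewrite addr_ge0 ?mulr_ge0 ?sqr_ge0.
have cy : 0 <= 1 + t * y ^+ 2 by rewrite addr_ge0 ?mulr_ge0 ?sqr_ge0.
have bA : #|T|%:R <= x ^+ 2 * (1 + t * y ^+ 2).
  apply: le_trans (card_fibres cy TA fA) _.
  by rewrite ler_wpM2r.
have bB : #|T|%:R <= y ^+ 2 * (1 + t * x ^+ 2).
  pose T' : {pred V * U} := [pred w | (w.2, w.1) \in T].
  have -> : #|T| = #|T'|.
    have swap_inj : injective (fun w : V * U => (w.2, w.1)).
      by move=> [v u] [v' u'] [-> ->].
    rewrite -(fintype.card_image swap_inj T'); apply: eq_card => -[u v].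
    by apply/idP/fintype.imageP => [uv|[[v' u'] uv' [-> ->]]//]; exists (v, u).
  apply: le_trans (_ : #|B|%:R * (1 + t * x ^+ 2) <= _); last by rewrite ler_wpM2r.
  by apply: card_fibres => // -[v u] uv; exact: (TB (u, v)).
have [xy|yx] := leP x y.
  apply: le_trans bA _.
  have -> : x ^+ 2 * (1 + t * y ^+ 2) = x * x + t * (x * y) ^+ 2 by ring.
  by rewrite lerD2r ler_wpM2l.
apply: le_trans bB _.
have -> : y ^+ 2 * (1 + t * x ^+ 2) = y * y + t * (x * y) ^+ 2 by ring.
by rewrite lerD2r ler_wpM2r// ltW.
Qed.

Lemma natr_form (R : realType) a b :
  (a ^ 2 * b ^ 3)%:R = a%:R ^+ 2 * b%:R ^+ 3 :> R.
Proof. by rewrite natrM !natrX. Qed.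

(** The bound [6 * X] is what intervals of length at most [4 * X] that start in
    [[X, 2 * X]] can reach. *)
Definition close (R : realType) (B : nat) (X D : R) (a b a' b' : nat) : bool :=
  [&& (B <= b < B.*2)%N, (B <= b' < B.*2)%N,
      X < (a ^ 2 * b ^ 3)%:R <= 6 * X, X < (a' ^ 2 * b' ^ 3)%:R <= 6 * X
    & `|(a ^ 2 * b ^ 3)%:R - (a' ^ 2 * b' ^ 3)%:R| <= D].

Lemma close_gt0 (R : realType) B (X D : R) a b a' b' : 0 < X ->
  close B X D a b a' b' -> (0 < a)%N /\ (0 < a')%N.
Proof.
move=> X0 /and5P[_ _ /andP[X1 _] /andP[X1' _] _].
by split; rewrite lt0n; apply/eqP => E; [move: X1|move: X1']; rewrite E mul0n ltNge ltW.
Qed.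

Section fibres.
Variables (R : realType) (K B g : nat) (X D : R).
Hypotheses (X0 : 0 < X) (D0 : 0 <= D) (B0 : (0 < B)%N) (g0 : (0 < g)%N).

(** Division by [a' ^ 2 * b ^ 3], which exceeds [X / 8] because [b' <= 2 * b] in
    a dyadic block, turns close monomials into close fractions. *)
Lemma close_ratio a b a' b' : close B X D a b a' b' ->
  `|(a%:R / a'%:R) ^+ 2 - (b'%:R / b%:R) ^+ 3| <= 8 * D / X.
Proof.
case/and5P=> /andP[Bb bB] /andP[Bb' bB'] /andP[X1 X2] /andP[X1' X2'] dD.
have b0 : 0 < b%:R :> R by rewrite ltr0n (leq_trans B0).
have a0' : 0 < a'%:R :> R.
  by rewrite ltr0n lt0n; apply/eqP => E; move: X1'; rewrite E mul0n ltNge ltW.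
have bb' : b'%:R <= 2 * b%:R :> R.
  by rewrite -natrM ler_nat mul2n (leq_trans (ltnW bB'))// leq_double.
have den : X / 8 <= a'%:R ^+ 2 * b%:R ^+ 3.
  rewrite ler_pdivrMr//; apply: le_trans (ltW X1') _.
  have -> : a'%:R ^+ 2 * b%:R ^+ 3 * 8 = a'%:R ^+ 2 * (2 * b%:R) ^+ 3 :> R by ring.
  rewrite natr_form ler_wpM2l ?sqr_ge0//.
  by rewrite lerXn2r// nnegrE ?mulr_ge0 ?ler0n.
have den0 : 0 < a'%:R ^+ 2 * b%:R ^+ 3 :> R by rewrite mulr_gt0 ?exprn_gt0.
have -> : (a%:R / a'%:R) ^+ 2 - (b'%:R / b%:R) ^+ 3 =
   ((a ^ 2 * b ^ 3)%:R - (a' ^ 2 * b' ^ 3)%:R) / (a'%:R ^+ 2 * b%:R ^+ 3) :> R.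
  by rewrite !natr_form; field; rewrite !gt_eqF.
rewrite normrM normfV (gtr0_norm den0) ler_pdivrMr//.
apply: le_trans dD _; apply: le_trans (_ : 8 * D / X * (X / 8) <= _).
  by have -> : 8 * D / X * (X / 8) = D by field; rewrite gt_eqF.
by rewrite ler_wpM2l// divr_ge0 ?mulr_ge0// ltW.
Qed.

(** The cubes of the fractions [b' / b] lie in an interval of length
    [16 * D / X]. Since these fractions exceed [1 / 2], their cubes are at least
    [3 / 4] times as far apart as the fractions themselves. This yields the
    constant [64 / 3], rounded up to the one of [card_close_a]. *)
Lemma card_close_b (a a' : nat) :
  #|[pred q : 'I_K * 'I_K | (gcdn q.1 q.2 == g) && close B X D a q.1 a' q.2]|%:R
    <= 1 + 56 * (D / X) * (2 * B%:R / g%:R) ^+ 2.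
Proof.
have rB0 : 0 < 2 * B%:R :> R by rewrite mulr_gt0 ?ltr0n.
have rg0 : 0 < g%:R :> R by rewrite ltr0n.
apply: le_trans (@card_spaced _ _ _ (fun q : 'I_K * 'I_K => (q.2%:R / q.1%:R) ^+ 3)
   ((a%:R / a'%:R) ^+ 2 - 8 * D / X) (16 * D / X) (3 / 4 * (g%:R / (2 * B%:R)) ^+ 2) _ _ _ _) _.
- by rewrite mulr_gt0// exprn_gt0// divr_gt0.
- by rewrite divr_ge0 ?mulr_ge0// ltW.
- move=> q; rewrite inE => /andP[_ /close_ratio]; rewrite ler_norml => /andP[h1 h2].
  have -> : 16 * D / X = 8 * D / X + 8 * D / X by ring.
  by apply/andP; split; lra.
- move=> [b b'] [c c'] /andP[/eqP/= gb /and5P[/andP[Bb bB] /andP[Bb' bB'] _ _ _]].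
  move=> /andP[/eqP/= gc /and5P[/andP[Bc cB] /andP[Bc' cB'] _ _ _]] neq.
  have half (n m : nat) : (B <= n)%N -> (0 < m)%N -> (m < B.*2)%N -> 1 / 2 <= n%:R / m%:R :> R.
    move=> Bn m0 mB; rewrite ler_pdivlMr ?ltr0n//.
    have : m%:R <= 2 * n%:R :> R.
      by rewrite -natrM ler_nat mul2n (leq_trans (ltnW mB))// leq_double.
    by lra.
  have le2B (m : nat) : (m < B.*2)%N -> m%:R <= 2 * B%:R :> R.
    by move=> mB; rewrite -natrM ler_nat mul2n ltnW.
  have b0 := leq_trans B0 Bb; have c0 := leq_trans B0 Bc.
  have b0' := leq_trans B0 Bb'; have c0' := leq_trans B0 Bc'.
  have r1 := half _ _ Bb' b0 bB; have r2 := half _ _ Bc' c0 cB.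
  have sp := @frac_spacing R g b' b c' c (2 * B%:R) g0 b0' b0 c0' c0.
  rewrite gcdnC gb gcdnC gc in sp.
  have {}sp : (g%:R / (2 * B%:R)) ^+ 2 <= `|b'%:R / b%:R - c'%:R / c%:R| :> R.
    apply: sp => //; [|exact: le2B..].
    by apply: contra neq => /eqP[/val_inj -> /val_inj ->].
  move: r1 r2 sp; set r := b'%:R / b%:R; set r' := c'%:R / c%:R => r1 r2 sp.
  have -> : r ^+ 3 - r' ^+ 3 = (r ^+ 2 + r * r' + r' ^+ 2) * (r - r') by ring.
  have h : 3 / 4 <= r ^+ 2 + r * r' + r' ^+ 2 by nra.
  by rewrite normrM ler_pM// ?sqr_ge0// (le_trans h)// ler_norm.
have -> : 16 * D / X / (3 / 4 * (g%:R / (2 * B%:R)) ^+ 2) =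
   64 / 3 * (D / X) * (2 * B%:R / g%:R) ^+ 2.
  by field; rewrite !gt_eqF//= ltr0n.
rewrite lerD2l ler_wpM2r ?sqr_ge0// ler_wpM2r ?divr_ge0 ?(ltW X0)//.
by lra.
Qed.

(** The condition on [A] makes it an upper bound for [a]; as [b] varies by a
    factor [2] and the monomial by a factor [6], [a] stays within a factor [7]
    of it. *)
Lemma close_range (A : R) (a c : nat) : 0 < A -> A ^+ 2 * B%:R ^+ 3 = 6 * X ->
  (B <= c < B.*2)%N -> X < (a ^ 2 * c ^ 3)%:R <= 6 * X ->
  a%:R <= A /\ A <= 7 * a%:R.
Proof.
move=> A0 AX /andP[Bc cB] /andP[X1 X2].
have Bc' : B%:R ^+ 3 <= c%:R ^+ 3 :> R.
  by rewrite lerXn2r ?nnegrE ?ler0n// ler_nat.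
have cB' : c%:R ^+ 3 <= (2 * B%:R) ^+ 3 :> R.
  by rewrite lerXn2r ?nnegrE ?mulr_ge0 ?ler0n// -natrM ler_nat mul2n ltnW.
have a2 : 0 <= a%:R ^+ 2 :> R := sqr_ge0 _.
move: X1 X2; rewrite natr_form => X1 X2.
have B3 : 0 < B%:R ^+ 3 :> R by rewrite exprn_gt0// ltr0n.
split.
  rewrite -(@ler_pXn2r _ 2)// ?nnegrE ?ler0n ?(ltW A0)//.
  by rewrite -(ler_pM2r B3) AX; apply: le_trans X2; rewrite ler_wpM2l.
rewrite -(@ler_pXn2r _ 2)// ?nnegrE ?mulr_ge0 ?ler0n ?(ltW A0)//.
rewrite -(ler_pM2r B3) AX.
have := ler_wpM2l a2 cB'.
have -> : a%:R ^+ 2 * (2 * B%:R) ^+ 3 = 8 * (a%:R ^+ 2 * B%:R ^+ 3) :> R by ring.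
have -> : (7 * a%:R) ^+ 2 * B%:R ^+ 3 = 49 * (a%:R ^+ 2 * B%:R ^+ 3) :> R by ring.
have : 0 <= a%:R ^+ 2 * B%:R ^+ 3 :> R by rewrite mulr_ge0// ltW.
by lra.
Qed.

(** The same argument for the squares of the fractions [a / a'], which are at
    least [1 / 7] by [close_range]. *)
Lemma card_close_a (A : R) (b b' : nat) : 0 < A -> A ^+ 2 * B%:R ^+ 3 = 6 * X ->
  #|[pred p : 'I_K * 'I_K | (gcdn p.1 p.2 == g) && close B X D p.1 b p.2 b']|%:R
    <= 1 + 56 * (D / X) * (A / g%:R) ^+ 2.
Proof.
move=> A0 AX.
have rB0 : 0 < B%:R :> R by rewrite ltr0n.
have rg0 : 0 < g%:R :> R by rewrite ltr0n.
apply: le_trans (@card_spaced _ _ _ (fun p : 'I_K * 'I_K => (p.1%:R / p.2%:R) ^+ 2)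
   ((b'%:R / b%:R) ^+ 3 - 8 * D / X) (16 * D / X) (2 / 7 * (g%:R / A) ^+ 2) _ _ _ _) _.
- by rewrite mulr_gt0// exprn_gt0// divr_gt0.
- by rewrite divr_ge0 ?mulr_ge0// ltW.
- move=> q; rewrite inE => /andP[_ /close_ratio]; rewrite ler_norml => /andP[h1 h2].
  have -> : 16 * D / X = 8 * D / X + 8 * D / X by ring.
  by apply/andP; split; lra.
- move=> [a a'] [c c'] /andP[/eqP/= ga cl1] /andP[/eqP/= gc cl2] neq.
  have [a0 a0'] := close_gt0 X0 cl1; have [c0 c0'] := close_gt0 X0 cl2.
  have /and5P[B1 B2 X1 X2 _] := cl1; have /and5P[B3 B4 X3 X4 _] := cl2.
  have [aA Aa] := close_range A0 AX B1 X1; have [aA' Aa'] := close_range A0 AX B2 X2.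
  have [cA Ac] := close_range A0 AX B3 X3; have [cA' Ac'] := close_range A0 AX B4 X4.
  have sp : (g%:R / A) ^+ 2 <= `|a%:R / a'%:R - c%:R / c'%:R| :> R.
    exact: frac_spacing.
  have seventh (n m : nat) : (0 < m)%N -> m%:R <= A -> A <= 7 * n%:R -> 1 / 7 <= n%:R / m%:R :> R.
    by move=> m0 mA An; rewrite ler_pdivlMr ?ltr0n//; lra.
  have r1 := seventh _ _ a0' aA' Aa; have r2 := seventh _ _ c0' cA' Ac.
  move: r1 r2 sp; set r := a%:R / a'%:R; set r' := c%:R / c'%:R => r1 r2 sp.
  have -> : r ^+ 2 - r' ^+ 2 = (r + r') * (r - r') by ring.
  have h : 2 / 7 <= r + r' by lra.
  by rewrite normrM ler_pM// ?sqr_ge0// (le_trans h)// ler_norm.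
have -> : 16 * D / X / (2 / 7 * (g%:R / A) ^+ 2) =
   56 * (D / X) * (A / g%:R) ^+ 2.
  by field; rewrite !gt_eqF.
by [].
Qed.

End fibres.

(** Each dyadic block of the harmonic sum is at most [1]. The term [m = 0]
    contributes [0^-1 = 0]. *)
Lemma sum_inv_lt_pow2 (R : realType) J :
  \sum_(m < 2 ^ J) (m%:R)^-1 <= J%:R :> R.
Proof.
rewrite -(big_mkord xpredT (fun m => m%:R^-1)).
elim: J => [|J IH]; first by rewrite expn0 big_nat1 invr0.
rewrite expnS mul2n -addnn (big_cat_nat _ (n := (2 ^ J)%N)) ?leq_addr//=.
rewrite -[leRHS]natr1 lerD//.
apply: le_trans (_ : \sum_(2 ^ J <= m < 2 ^ J + 2 ^ J) ((2 ^ J)%:R)^-1 <= _).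
  rewrite big_nat_cond [leRHS]big_nat_cond; apply: ler_sum => m /andP[/andP[h _] _].
  have p0 : (0 < 2 ^ J)%N by rewrite expn_gt0.
  by rewrite lef_pV2 ?posrE ?ltr0n ?ler_nat// (leq_trans p0).
by rewrite sumr_const_nat addnK -(mulr_natl _^-1) divff// pnatr_eq0 expn_eq0.
Qed.

(** Sort the quadruples by [m = gcd a a'] and [n = gcd b b']. For fixed [m] and
    [n] the bound of [card_two_fibres] applies with [x = A / m] and
    [y = 2 * B / n], and the sum over [m] and [n] costs two harmonic sums. *)
Lemma card_close (R : realType) (J B : nat) (X D A : R) :
  0 < X -> 0 <= D -> (0 < B)%N -> 0 < A -> A ^+ 2 * B%:R ^+ 3 = 6 * X ->
  #|[pred t : ('I_(2 ^ J) * 'I_(2 ^ J)) * ('I_(2 ^ J) * 'I_(2 ^ J)) |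
      close B X D t.1.1 t.2.1 t.1.2 t.2.2]|%:R <=
  J%:R ^+ 2 * (A * (2 * B%:R) + 56 * (D / X) * (A * (2 * B%:R)) ^+ 2).
Proof.
move=> X0 D0 B0 A0 AX; set K := (2 ^ J)%N; set T := [pred t | _].
have gcd_lt (p : 'I_K * 'I_K) : (gcdn p.1 p.2 < K)%N.
  case: p => -[[|a] ha] [b hb] /=; first by rewrite gcd0n.
  by rewrite (leq_ltn_trans _ ha)// dvdn_leq// dvdn_gcdl.
pose gs (t : ('I_K * 'I_K) * ('I_K * 'I_K)) := (Ordinal (gcd_lt t.1), Ordinal (gcd_lt t.2)).
set P := A * (2 * B%:R); set t := 56 * (D / X).
have B0' : 0 < 2 * B%:R :> R by rewrite mulr_gt0 ?ltr0n.
have P0 : 0 <= P by rewrite mulr_ge0// ltW.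
have t0 : 0 <= t by rewrite mulr_ge0// divr_ge0// ltW.
have PP0 : 0 <= P + t * P ^+ 2 by rewrite addr_ge0 // mulr_ge0 ?sqr_ge0.
rewrite -sum1_card (partition_big gs xpredT)//= natr_sum.
apply: le_trans (_ : \sum_(g : 'I_K * 'I_K) g.1%:R^-1 * g.2%:R^-1 * (P + t * P ^+ 2) <= _); last first.
  rewrite -mulr_suml ler_wpM2r//.
  have -> : \sum_(g : 'I_K * 'I_K) g.1%:R^-1 * g.2%:R^-1 =
      (\sum_(m < K) m%:R^-1) * (\sum_(n < K) n%:R^-1) :> R.
    by rewrite big_distrlr pair_bigA.
  rewrite expr2 ler_pM ?sum_inv_lt_pow2//;
    by apply: sumr_ge0 => i _; rewrite invr_ge0.
apply: ler_sum => -[m n] _ /=; rewrite sum1_card.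
set Tmn := (X in #|X|%:R <= _).
have [m0|m0] := posnP m.
  rewrite (_ : #|Tmn| = 0%N) ?m0 ?invr0 ?mul0r//; apply: eq_card0 => -[[a a'] [b b']].
  apply/negP => /andP[/= cl /eqP[/(congr1 val)/= E _]].
  by have [a0 _] := close_gt0 X0 cl; move: (gcdn_gt0 a a'); rewrite E m0 a0.
have [n0|n0] := posnP n.
  rewrite (_ : #|Tmn| = 0%N) ?n0 ?invr0 ?mulr0 ?mul0r//; apply: eq_card0 => -[[a a'] [b b']].
  apply/negP => /andP[/= cl /eqP[_ /(congr1 val)/= E]].
  have /and5P[/andP[Bb _] _ _ _ _] := cl.
  by move: (gcdn_gt0 b b'); rewrite E n0 (leq_trans B0 Bb).
have inv1 (k : nat) : (0 < k)%N -> 0 <= (k%:R^-1 : R) <= 1.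
  by move=> k0; rewrite invr_ge0 ler0n invf_le1 ?ltr0n// ler1n.
pose x := A / m%:R; pose y := 2 * B%:R / n%:R : R.
have x0 : 0 <= x by rewrite divr_ge0 ?ler0n// ltW.
have y0 : 0 <= y by rewrite divr_ge0 ?ler0n// ltW.
(* Since [(m * n) ^- 2 <= (m * n) ^- 1], both terms are summed with the weight
   [(m * n) ^- 1]. *)
apply: le_trans (_ : x * y + t * (x * y) ^+ 2 <= _); last first.
  have -> : x * y = m%:R^-1 * n%:R^-1 * P by rewrite /x /y /P; ring.
  have /andP[im0 im1] := inv1 _ m0; have /andP[in0 in1] := inv1 _ n0.
  set c := m%:R^-1 * n%:R^-1.
  have c0 : 0 <= c by rewrite mulr_ge0.
  have c1 : c <= 1 by rewrite mulr_ile1.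
  have -> : c * P + t * (c * P) ^+ 2 = c * (P + t * P ^+ 2 * c) by ring.
  by rewrite ler_wpM2l// lerD2l ler_piMr// mulr_ge0 ?sqr_ge0.
have inT a a' b b' : ((a, a'), (b, b')) \in Tmn ->
    [/\ close B X D a b a' b', gcdn a a' = m & gcdn b b' = n].
  by move=> /andP[/= cl /eqP[E1 E2]]; split=> //; rewrite -?E1 -?E2.
apply: (card_two_fibres
  (A := [pred p : 'I_K * 'I_K | [&& (0 < p.1)%N, (0 < p.2)%N, gcdn p.1 p.2 == m,
       (p.1%:R <= A) & (p.2%:R <= A)]])
  (B := [pred p : 'I_K * 'I_K | [&& (0 < p.1)%N, (0 < p.2)%N, gcdn p.1 p.2 == n,
       (p.1%:R <= 2 * B%:R :> R) & (p.2%:R <= 2 * B%:R :> R)]])) => //.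
- move=> [[a a'] [b b']] /inT[cl ga gb]; rewrite inE /= ga eqxx.
  have [a0 a0'] := close_gt0 X0 cl; have /and5P[B1 B2 X1 X2 _] := cl.
  have [aA _] := close_range B0 A0 AX B1 X1.
  have [aA' _] := close_range B0 A0 AX B2 X2.
  by rewrite a0 a0' aA aA'.
- move=> [[a a'] [b b']] /inT[cl ga gb]; rewrite inE /= gb eqxx.
  have /and5P[/andP[B1 B1'] /andP[B2 B2'] _ _ _] := cl.
  have le2B (c : nat) : (c < B.*2)%N -> c%:R <= 2 * B%:R :> R.
    by move=> cB; rewrite -natrM ler_nat mul2n ltnW.
  by rewrite (leq_trans B0 B1) (leq_trans B0 B2) le2B// le2B.
- exact/card_gcd_pairs/m0/ltW.
- exact/card_gcd_pairs/n0/ltW.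
- move=> [a a']; apply: le_trans (card_close_b K X0 D0 B0 n0 a a').
  rewrite ler_nat; apply: subset_leq_card; apply/fintype.subsetP => -[b b'] /inT[cl ga gb].
  by rewrite inE /= gb eqxx cl.
- move=> [b b']; apply: le_trans (card_close_a K X0 D0 B0 m0 b b' A0 AX).
  rewrite ler_nat; apply: subset_leq_card; apply/fintype.subsetP => -[a a'] /inT[cl ga gb].
  by rewrite inE /= ga eqxx cl.
Qed.

(** * Counting squarefull numbers in an interval *)

Lemma card_ord_itv K t : (t < K)%N -> #|[pred a : 'I_K | (0 < a <= t)%N]| = t.
Proof.
move=> tK; rewrite -sum1_card big_mkcond /=.
rewrite -(big_mkord xpredT (fun a => if (0 < a <= t)%N then 1 else 0)%N).
rewrite (big_cat_nat _ (n := t.+1)) //= [X in (_ + X)%N]big_nat_cond.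
rewrite [X in (_ + X)%N]big1 ?addn0; last first.
  by move=> a /andP[/andP[ta _] _]; rewrite [(a <= t)%N]leqNgt ta andbF.
rewrite big_nat_recl//= add0n big_nat_cond.
rewrite (eq_bigr (fun=> 1%N)); last by move=> a /andP[/andP[_ ->]].
by rewrite -big_nat_cond sum_nat_const_nat subn0 muln1.
Qed.

Section counting.
Variable R : realType.
Implicit Types (x v H : R) (K a b : nat).

Definition root_count K b x : nat :=
  #|[pred a : 'I_K | (0 < a)%N && ((a ^ 2 * b ^ 3)%:R <= x)]|.

Definition root_count_itv K b x x' : nat :=
  #|[pred a : 'I_K | x < (a ^ 2 * b ^ 3)%:R <= x']|.

Lemma root_countD K b x x' : 0 <= x -> x <= x' ->
  root_count K b x' = (root_count K b x + root_count_itv K b x x')%N.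
Proof.
move=> x0 xx'; rewrite /root_count /root_count_itv.
rewrite -(cardID [pred a : 'I_K | (a ^ 2 * b ^ 3)%:R <= x]); congr (_ + _)%N.
  apply: eq_card => a; rewrite !inE; apply/andP/andP => [[/andP[a0 _] ax]//|[a0 ax]].
  by rewrite a0 ax (le_trans ax).
apply: eq_card => a; rewrite !inE -ltNge; case: (ltP x) => //= xa.
suff -> : (0 < a)%N by [].
by rewrite lt0n; apply/eqP => E; move: xa; rewrite E mul0n ltNge x0.
Qed.

(** The real power [b ^ (3 / 2)]. *)
Definition theta b : R := Num.sqrt (b%:R ^+ 3).

Lemma theta_gt0 b : (0 < b)%N -> 0 < theta b.
Proof. by move=> b0; rewrite sqrtr_gt0 exprn_gt0 ?ltr0n. Qed.

Lemma theta_ge1 b : (0 < b)%N -> 1 <= theta b.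
Proof.
move=> b0; rewrite -[leLHS]sqrtr1 ler_sqrt ?exprn_ge0//.
by rewrite -natrX ler1n expn_gt0 b0.
Qed.

(** The condition [a ^ 2 * b ^ 3 <= v ^ 2] says [a <= v / theta b]; the bound
    [v ^ 2 < K] ensures that every such [a] is below [K]. *)
Lemma root_count_truncn K b v : 0 <= v -> v ^+ 2 < K%:R -> (0 < b)%N ->
  root_count K b (v ^+ 2) = Num.truncn (v / theta b).
Proof.
move=> v0 vK b0; have t0 := theta_gt0 b0.
have w0 : 0 <= v / theta b by rewrite divr_ge0// ltW.
rewrite -[RHS](@card_ord_itv K); last first.
  have /andP[tv _] := truncn_itv w0; set t := Num.truncn _ in tv *.
  rewrite -(ltr_nat R); apply: le_lt_trans vK.
  apply: le_trans (_ : (t ^ 2)%:R <= _).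
    by rewrite ler_nat -mulnn; case: (t) => // n; rewrite leq_pmulr.
  rewrite natrX lerXn2r ?nnegrE//; apply: le_trans tv _.
  by rewrite ler_pdivrMr// ler_peMr// theta_ge1.
apply: eq_card => a; rewrite !inE; congr (_ && _).
rewrite truncn_ge_nat// ler_pdivlMr// natr_form.
rewrite -(@ler_pXn2r _ 2 _ (a%:R * theta b))// ?nnegrE ?mulr_ge0 ?ler0n ?(ltW t0)//.
by rewrite exprMn sqr_sqrtr ?exprn_ge0.
Qed.

(** Number the squarefull integers by their unique representation
    [a ^ 2 * b ^ 3] with [b] squarefree. *)
Lemma squarefull_count_roots K x : 0 <= x -> x < K%:R ->
  squarefull_count x = (\sum_(0 <= b < K | squarefree b) root_count K b x)%N.
Proof.
move=> x0 xK.
have tK : (Num.truncn x < K)%N by rewrite truncn_lt_nat.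
have K0 : (0 < K)%N by case: (K) tK.
pose P := [set p : 'I_K * 'I_K |
   [&& (0 < p.1)%N, squarefree p.2 & (p.1 ^ 2 * p.2 ^ 3)%:R <= x]]%SET.
have -> : (\sum_(0 <= b < K | squarefree b) root_count K b x = #|P|)%N.
  rewrite big_mkord -sum1_card.
  rewrite (eq_bigr (fun b : 'I_K =>
      \sum_(a : 'I_K | (0 < a)%N && ((a ^ 2 * b ^ 3)%:R <= x)%R) 1)%N); last first.
    by move=> b _; rewrite sum1_card.
  rewrite pair_big_dep /=.
  rewrite (reindex (fun p : 'I_K * 'I_K => (p.2, p.1))) /=; last first.
    by exists (fun p => (p.2, p.1)) => -[].
  by apply: eq_bigl => -[a b]; rewrite !inE /= andbCA.
pose f (p : 'I_K * 'I_K) : 'I_K.-1.+1 := inord (p.1 ^ 2 * p.2 ^ 3).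
have fP p : p \in P -> f p = (p.1 ^ 2 * p.2 ^ 3)%N :> nat.
  rewrite inE => /and3P[_ _ px]; rewrite inordK// prednK//.
  by rewrite -(ltr_nat R) (le_lt_trans px).
have finj : {in P &, injective f}.
  move=> [a b] [a' b'] p p' /(congr1 val) /=; rewrite (fP _ p) (fP _ p') /=.
  move: p p'; rewrite !inE /= => /and3P[a0 sb _] /and3P[a0' sb' _] E.
  have [] := squarefull_form_inj a0 a0' sb sb' E.
  by move=> /val_inj -> /val_inj ->.
rewrite -(card_in_imset finj).
have -> : squarefull_count x =
    #|[pred n : 'I_K.-1.+1 | (0 < n <= Num.truncn x)%N && squarefull n]|.
  rewrite /squarefull_count -sum1_count -sum1_card big_mkcond /=.
  rewrite -[X in iota 1 X](subn1 (Num.truncn x).+1) -/(index_iota 1 _).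
  rewrite [RHS]big_mkcond /=.
  rewrite -(big_mkord xpredT (fun n => if (0 < n <= Num.truncn x)%N && squarefull n then 1 else 0)%N).
  rewrite prednK// (big_cat_nat (n := (Num.truncn x).+1) _ tK)//=.
  rewrite [X in (_ + X)%N]big_nat_cond [X in (_ + X)%N]big1 ?addn0; last first.
    by move=> n /andP[/andP[ta _] _]; rewrite [(n <= _)%N]leqNgt ta andbF.
  rewrite [RHS]big_ltn//= add0n; apply: eq_big_nat => n /andP[n0 nx].
  by rewrite n0 -ltnS nx.
apply: eq_card => n; rewrite inE; apply/idP/imsetP.
  move=> /andP[/andP[n0 nx] /squarefull_decomp[a [b [a0 sb En]]]].
  have b0 := squarefree_gt0 sb.
  have nK : (n < K)%N := leq_ltn_trans nx tK.
  have aK : (a < K)%N.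
    apply: leq_ltn_trans nK; rewrite En -mulnn -mulnA leq_pmulr// muln_gt0 a0.
    by rewrite expn_gt0 b0.
  have bK : (b < K)%N.
    apply: leq_ltn_trans nK; have -> : n = (b * (b ^ 2 * a ^ 2))%N :> nat by rewrite En; ring.
    by rewrite leq_pmulr// muln_gt0 !expn_gt0 a0 b0.
  have inP : (Ordinal aK, Ordinal bK) \in P.
    by rewrite inE /= a0 sb -truncn_ge_nat// -En.
  by exists (Ordinal aK, Ordinal bK) => //; apply: val_inj; rewrite /= (fP _ inP).
move=> [p pP ->]; rewrite (fP _ pP); move: pP; rewrite inE => /and3P[p0 sp px].
have b0 := squarefree_gt0 sp.
by rewrite squarefull_form// muln_gt0 !expn_gt0 p0 b0 /= truncn_ge_nat// px.
Qed.

End counting.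

(** * The density constant *)

Lemma ler_sum_subset (R : realType) (I : finType) (P Q : pred I) (F : I -> R) :
  (forall i, P i -> Q i) -> (forall i, 0 <= F i) ->
  \sum_(i | P i) F i <= \sum_(i | Q i) F i.
Proof.
move=> PQ F0; rewrite big_mkcond [leRHS]big_mkcond; apply: ler_sum => i _.
by case: ifP => [/PQ ->//|_]; case: ifP.
Qed.

Section density.
Variable R : realType.
Local Notation th := (theta R).

Lemma theta_sqr b : th b ^+ 2 = b%:R ^+ 3.
Proof. by rewrite sqr_sqrtr ?exprn_ge0. Qed.

Lemma theta_ge0 b : 0 <= th b.
Proof. exact: sqrtr_ge0. Qed.

Lemma thetaM b m : th (b * m ^ 2) = th b * m%:R ^+ 3.
Proof.
rewrite /th natrM natrX exprMn sqrtrM ?exprn_ge0//; congr (_ * _).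
by rewrite -exprM mulnC exprM sqrtr_sqr ger0_norm ?exprn_ge0.
Qed.

Lemma powR_theta n : (n.+1%:R : R) `^ (3 / 2) = th n.+1.
Proof.
by rewrite powRrM powR_mulrn ?ler0n// powR12_sqrt ?exprn_ge0.
Qed.

(** With [s = sqrt b] and [t = sqrt (b + 1)], [(t - s) * (t + s) = 1] reduces the
    claim to [t * (t + s) <= 4 * s ^ 2]. *)
Lemma inv_theta_telescope b : (0 < b)%N ->
  (th b)^-1 <= 4 * ((Num.sqrt b%:R)^-1 - (Num.sqrt b.+1%:R)^-1) :> R.
Proof.
move=> b0; have -> : th b = Num.sqrt b%:R ^+ 3 :> R.
  rewrite -[RHS]ger0_norm ?exprn_ge0 ?sqrtr_ge0// -sqrtr_sqr.
  by rewrite exprAC sqr_sqrtr ?ler0n.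
set s := Num.sqrt _; set t := Num.sqrt _.
have s2 : s ^+ 2 = b%:R by rewrite sqr_sqrtr.
have t2 : t ^+ 2 = s ^+ 2 + 1 by rewrite s2 sqr_sqrtr// natr1.
have s1 : 1 <= s ^+ 2 by rewrite s2 ler1n.
have s0 : 0 < s by rewrite sqrtr_gt0 ltr0n.
have t0 : 0 < t by rewrite sqrtr_gt0 ltr0n.
have key : t * (t + s) <= 4 * s ^+ 2 by nra.
have ts : (t - s) * (t + s) = 1 by rewrite -subr_sqr t2 addrAC subrr add0r.
have -> : 4 * (s^-1 - t^-1) = (4 * s ^+ 2) / (t * (t + s)) * (s ^+ 3)^-1.
  have -> : (4 * s ^+ 2) / (t * (t + s)) = 4 * s ^+ 2 * ((t - s) * (t + s)) / (t * (t + s)).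
    by rewrite ts mulr1.
  by field; rewrite !gt_eqF// addr_gt0.
have p0 : 0 < t * (t + s) by rewrite mulr_gt0// addr_gt0.
by rewrite ler_peMl ?invr_ge0 ?exprn_ge0 ?(ltW s0)// ler_pdivlMr// mul1r.
Qed.

Lemma sum_inv_theta_le m n : (0 < m)%N -> (m <= n)%N ->
  \sum_(m <= b < n) (th b)^-1 <= 4 / Num.sqrt m%:R :> R.
Proof.
move=> m0 mn.
apply: le_trans (_ : 4 * ((Num.sqrt m%:R)^-1 - (Num.sqrt n%:R)^-1) <= _); last first.
  by rewrite ler_wpM2l// gerBl invr_ge0 sqrtr_ge0.
apply: le_trans (_ : \sum_(m <= b < n) 4 * ((Num.sqrt b%:R)^-1 - (Num.sqrt b.+1%:R)^-1) <= _).
  rewrite big_nat_cond [leRHS]big_nat_cond; apply: ler_sum => b /andP[/andP[mb _] _].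
  exact: inv_theta_telescope (leq_trans m0 mb).
rewrite -mulr_sumr ler_wpM2l//.
have := @telescope_sumr R m n (fun b => - (Num.sqrt b%:R)^-1) mn.
rewrite opprK addrC => <-; apply: ler_sum => b _.
by rewrite opprK addrC.
Qed.

Let Z n : R := \sum_(1 <= b < n.+1) (th b)^-1.
Let G n : R := \sum_(1 <= b < n.+1 | squarefree b) (th b)^-1.
Let Z3 n : R := \sum_(1 <= m < n.+1) (m%:R ^+ 3)^-1.

Lemma cvg_sum_le_theta (P : pred nat) (f : nat -> R) :
  (forall b, (0 < b)%N -> 0 <= f b <= (th b)^-1) ->
  cvgn (fun n => \sum_(1 <= b < n.+1 | P b) f b).
Proof.
move=> fP; apply: nondecreasing_is_cvgn.
  apply/nondecreasing_seqP => n; rewrite [leRHS]big_mkcond big_nat_recr//= -big_mkcond.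
  by case: ifP => _; rewrite ?addr0// lerDl; have /andP[] := fP n.+1 isT.
exists 4 => _ [n _ <-] /=.
apply: le_trans (_ : \sum_(1 <= b < n.+1) (th b)^-1 <= _).
  rewrite big_mkcond /= big_nat_cond [leRHS]big_nat_cond.
  apply: ler_sum => b /andP[/andP[b0 _] _]; have /andP[f0 f1] := fP b b0.
  by case: ifP => // _; rewrite invr_ge0 theta_ge0.
apply: le_trans (sum_inv_theta_le _ _) _ => //.
by rewrite sqrtr1 divr1.
Qed.

(** Every positive integer is uniquely [b * m ^ 2] with [b] squarefree, and
    [th (b * m ^ 2) = th b * m ^ 3], so [G n * Z3 n] is a partial sum of
    [1 / th] in another order, containing all the terms up to [n]. *)
Lemma squarefree_sum_sandwich n : Z n <= G n * Z3 n <= Z (n ^ 3).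
Proof.
pose P := [set p : 'I_n.+1 * 'I_n.+1 | squarefree p.1 && (0 < p.2)%N]%SET.
pose f (p : 'I_n.+1 * 'I_n.+1) : 'I_(n ^ 3).+1 := inord (p.1 * p.2 ^ 2).
have fE p : f p = (p.1 * p.2 ^ 2)%N :> nat.
  rewrite inordK// ltnS; case: p => b m /=.
  rewrite (expnS n 2); apply: leq_mul; first exact: leq_ord.
  by rewrite leq_exp2r// leq_ord.
have finj : {in P &, injective f}.
  move=> [b m] [b' m']; rewrite !inE /= => /andP[sb m0] /andP[sb' m0'].
  move=> /(congr1 val) /=; rewrite !fE /= => E.
  have [] := squarefree_part_inj sb sb' m0 m0' E.
  by move=> /val_inj -> /val_inj ->.
have nat_ord N (Q : pred nat) (F : nat -> R) :
    \sum_(1 <= b < N.+1 | Q b) F b = \sum_(b < N.+1 | (0 < b)%N && Q b) F b.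
  rewrite -(big_mkord (fun b => (0 < b)%N && Q b)) [RHS]big_ltn_cond//=.
  rewrite [LHS]big_nat_cond [RHS]big_nat_cond; apply: eq_bigl => b.
  by case: posnP => [->|]; rewrite ?andbF.
have -> : G n * Z3 n = \sum_(k in [set f p | p in P]%SET) (th k)^-1.
  rewrite big_imset//= /G /Z3 !nat_ord big_distrlr pair_big_dep /=.
  apply: eq_big => [[b m]|[b m] _]; last by rewrite fE thetaM [RHS]invfM.
  rewrite inE /= andbT; case sb : (squarefree b); rewrite ?andbF//.
  by rewrite (squarefree_gt0 sb).
have th0 k : 0 <= (th k)^-1 by rewrite invr_ge0 theta_ge0.
apply/andP; split; rewrite /Z nat_ord.
  rewrite (big_ord_widen_cond (n ^ 3).+1 (fun b => (0 < b)%N && true) (fun b => (th b)^-1)); last first.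
    by rewrite ltnS; case: (n) => // m; rewrite expnS leq_pmulr ?expn_gt0.
  apply: ler_sum_subset => // k; rewrite andbT ltnS => /andP[k0 kn].
  have [b [m [sb m0 Ek]]] := squarefree_part k0.
  have b0 := squarefree_gt0 sb.
  have bn : (b < n.+1)%N.
    by rewrite ltnS (leq_trans _ kn)// Ek leq_pmulr// expn_gt0 m0.
  have mn : (m < n.+1)%N.
    rewrite ltnS (leq_trans _ kn)// Ek -mulnn mulnCA leq_pmulr// muln_gt0 b0.
    exact: m0.
  apply/imsetP; exists (Ordinal bn, Ordinal mn); first by rewrite inE /= sb.
  by apply: val_inj; rewrite /= fE.
apply: ler_sum_subset => // k /imsetP[p]; rewrite inE => /andP[sp p0] ->.
by rewrite fE muln_gt0 expn_gt0 p0 (squarefree_gt0 sp).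
Qed.

Lemma zeta_3_2 : zeta (3 / 2) = limn Z :> R.
Proof.
congr (limn _); apply/funext => n; rewrite /Z big_add1 /= /series /=.
by apply: eq_bigr => k _; rewrite powR_theta.
Qed.

Lemma zeta_3 : zeta 3 = limn Z3 :> R.
Proof.
congr (limn _); apply/funext => n; rewrite /Z3 big_add1 /= /series /=.
by apply: eq_bigr => k _; rewrite powR_mulrn.
Qed.

(** Squeezing [G n * Z3 n] between [Z n] and [limn Z] identifies the limit of
    [G] as the quotient of the two zeta values. *)
Lemma cvg_squarefree_sum : G n @[n --> \oo] --> zeta (3 / 2) / zeta 3.
Proof.
have cZ : cvgn Z by apply: cvg_sum_le_theta => b _; rewrite lexx invr_ge0 theta_ge0.
have cG : cvgn G by apply: cvg_sum_le_theta => b _; rewrite lexx invr_ge0 theta_ge0.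
have cZ3 : cvgn Z3.
  apply: cvg_sum_le_theta => b b0; rewrite invr_ge0 exprn_ge0//=.
  have t1 := theta_ge1 R b0; have t0 := theta_gt0 R b0.
  by rewrite -theta_sqr lef_pV2 ?posrE ?exprn_gt0// expr2 ler_peMr// ltW.
have ndZ : {homo Z : n m / (n <= m)%N >-> n <= m}.
  apply/nondecreasing_seqP => n; rewrite [leRHS]big_nat_recr//= lerDl.
  by rewrite invr_ge0 theta_ge0.
have Z3ge1 n : (0 < n)%N -> 1 <= Z3 n.
  move=> n0; rewrite /Z3 big_ltn// expr1n invr1 lerDl.
  by apply: sumr_ge0 => i _; rewrite invr_ge0 exprn_ge0.
have lZ3 : 1 <= limn Z3 by apply: limr_ge => //; exists 1%N => // n /= /Z3ge1.
have GZ3 : G n * Z3 n @[n --> \oo] --> limn Z.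
  apply: (squeeze_cvgr _ cZ (cvg_cst (limn Z))).
  apply: nearW => n; have /andP[-> le3] /= := squarefree_sum_sandwich n.
  by apply: le_trans le3 _; apply: nondecreasing_cvgn_le.
have lim_eq : limn G * limn Z3 = limn Z.
  by apply: (cvg_unique _ _ GZ3) => //; apply: cvgM.
rewrite zeta_3_2 zeta_3 -lim_eq mulfK ?gt_eqF ?(lt_le_trans _ lZ3)//.
Qed.

(** The tail of the density constant is dominated by the tail of the full sum of
    [1 / th], which telescopes. *)
Lemma squarefree_tail z : (0 < z)%N ->
  0 <= zeta (3 / 2) / zeta 3 - \sum_(1 <= b < z | squarefree b) (th b)^-1
    <= 4 / Num.sqrt z%:R.
Proof.
move=> z0; set g := \sum_(_ <= _ < _ | _) _.
have cG := cvg_squarefree_sum; rewrite -(cvg_lim _ cG)//.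
have GE n : (z <= n)%N -> g <= G n <= g + 4 / Num.sqrt z%:R.
  move=> zn; rewrite /G (big_cat_nat (n := z))//=; last exact: leqW.
  have s0 : 0 <= \sum_(z <= b < n.+1 | squarefree b) (th b)^-1.
    by apply: sumr_ge0 => i _; rewrite invr_ge0 theta_ge0.
  rewrite lerDl s0 lerD2l /= (le_trans _ (sum_inv_theta_le z0 (leqW zn)))//.
  rewrite big_mkcond; apply: ler_sum => i _; case: ifP => // _.
  by rewrite invr_ge0 theta_ge0.
rewrite subr_ge0 lerBlDl; apply/andP; split.
  by apply: limr_ge; [exact: cvgP cG|exists z => // n /= /GE/andP[]].
by apply: limr_le; [exact: cvgP cG|exists z => // n /= /GE/andP[]].
Qed.

End density.

(** * Deviation at a point *)

Lemma truncnD_dist (R : realType) (v h : R) : 0 <= v -> 0 <= h ->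
  `|(Num.truncn (v + h))%:R - (Num.truncn v)%:R - h| <= 1.
Proof.
move=> v0 h0; have /andP[a1 a2] := truncn_itv v0.
have /andP[b1 b2] := truncn_itv (addr_ge0 v0 h0).
by rewrite ler_norml; rewrite -natr1 in a2; rewrite -natr1 in b2; apply/andP; split; lra.
Qed.

Lemma interval_length_sqr (R : realType) (H x : R) : 0 <= x ->
  x + interval_length H x = (Num.sqrt x + H) ^+ 2.
Proof.
move=> x0; by rewrite /interval_length sqrrD sqr_sqrtr//; ring.
Qed.

(** Pointwise form of the truncation at [z]: an error at most [1] for each
    [b < z], the tail of the main term, and the untouched count for [z <= b]. *)
Lemma deviation_le (R : realType) (x H : R) (K z : nat) :
  0 <= x -> 0 <= H -> x + interval_length H x < K%:R -> (0 < z)%N -> (z <= K)%N ->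
  `| (squarefull_count (x + interval_length H x))%:R - (squarefull_count x)%:R
      - zeta (3 / 2) / zeta 3 * H |
  <= z%:R + H * (4 / Num.sqrt z%:R)
     + (\sum_(z <= b < K) root_count_itv K b x (x + interval_length H x))%:R.
Proof.
move=> x0 H0 xK z0 zK; set x' := x + interval_length H x.
have xx' : x <= x'.
  by rewrite lerDl addr_ge0 ?sqr_ge0// mulr_ge0// mulr_ge0// sqrtr_ge0.
have x'0 : 0 <= x' := le_trans x0 xx'.
rewrite (squarefull_count_roots x'0 xK) (squarefull_count_roots x0 (le_lt_trans xx' xK)).
have -> : (\sum_(0 <= b < K | squarefree b) root_count K b x')%:R -
    (\sum_(0 <= b < K | squarefree b) root_count K b x)%:R =
    (\sum_(0 <= b < K | squarefree b) root_count_itv K b x x')%:R :> R.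
  rewrite -natrB; last by apply: leq_sum => b _; rewrite (root_countD K b x0 xx') leq_addr.
  congr (_%:R); rewrite -sumnB; last by move=> b _; rewrite (root_countD K b x0 xx') leq_addr.
  by apply: eq_bigr => b _; rewrite (root_countD K b x0 xx') addKn.
have K0 : (0 < K)%N := leq_trans z0 zK.
rewrite big_ltn_cond//= (big_cat_nat (n := z))//= natrD.
set S1 := (\sum_(1 <= b < z | _) _)%N; set S2 := (\sum_(_ <= b < _ | _) _)%N.
have S2le : S2%:R <= (\sum_(z <= b < K) root_count_itv K b x x')%:R :> R.
  by rewrite ler_nat /S2 big_mkcond; apply: leq_sum => b _; case: ifP.
set g := \sum_(1 <= b < z | squarefree b) (theta R b)^-1.
have /andP[c1 c2] := squarefree_tail R z0; rewrite -/g in c1 c2.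
have main : `|S1%:R - g * H| <= z%:R.
  rewrite /S1 /g natr_sum mulr_suml -sumrB (le_trans (ler_norm_sum _ _ _))//.
  apply: le_trans (_ : \sum_(1 <= b < z) 1 <= _); last first.
    by rewrite sumr_const_nat ler_nat leq_subr.
  rewrite big_mkcond /= big_nat_cond [leRHS]big_nat_cond.
  apply: ler_sum => b /andP[/andP[b0 bz] _]; case: ifP => // _.
  have t0 := theta_gt0 R b0.
  have := root_countD K b x0 xx'.
  rewrite /x' interval_length_sqr// -{2 3}(sqr_sqrtr x0).
  rewrite !root_count_truncn ?addr_ge0 ?sqrtr_ge0//; last 2 first.
  - by rewrite sqr_sqrtr// (le_lt_trans xx').
  - by rewrite -interval_length_sqr.
  move=> /(congr1 (fun n => n%:R : R)); rewrite natrD sqr_sqrtr// => E.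
  have tr : `|(Num.truncn (Num.sqrt x / theta R b + H / theta R b))%:R
      - (Num.truncn (Num.sqrt x / theta R b))%:R - H / theta R b| <= 1 :> R.
    by apply: truncnD_dist; rewrite divr_ge0 ?sqrtr_ge0// ltW.
  rewrite -mulrDl E in tr; apply: le_trans tr.
  by rewrite le_eqVlt; apply/orP; left; apply/eqP; congr `|_|; ring.
set c := zeta (3 / 2) / zeta 3.
have -> : S1%:R + S2%:R - c * H = (S1%:R - g * H) + (S2%:R - (c - g) * H) by ring.
apply: le_trans (ler_normD _ _) _; rewrite -addrA lerD//.
apply: le_trans (ler_normB _ _) _; rewrite [leRHS]addrC lerD//.
  by rewrite ger0_norm ?ler0n.
by rewrite ger0_norm ?mulr_ge0// mulrC ler_wpM2l.
Qed.

(** * Second moment of the large part *)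

Lemma sqr_sum_le (R : realType) (k J : nat) (s : nat -> R) : (k <= J)%N ->
  (\sum_(k <= j < J) s j) ^+ 2 <= J%:R * \sum_(k <= j < J) s j ^+ 2.
Proof.
move=> kJ; rewrite expr2 big_distrlr /=.
apply: le_trans (_ : \sum_(k <= i < J) \sum_(k <= j < J) (s i ^+ 2 / 2 + s j ^+ 2 / 2) <= _).
  apply: ler_sum => i _; apply: ler_sum => j _.
  have := sqr_ge0 (s i - s j); rewrite sqrrB; lra.
rewrite [leLHS](eq_bigr (fun i => s i ^+ 2 / 2 *+ (J - k) +
    \sum_(k <= j < J) s j ^+ 2 / 2)); last first.
  by move=> i _; rewrite big_split /= sumr_const_nat.
rewrite big_split /= sumr_const_nat sumrMnl -mulr_suml.
set S := \sum_(_ <= _ < _) _.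
rewrite -mulrnDl -splitr -(mulr_natl S) ler_wpM2r ?ler_nat ?leq_subr//.
by apply: sumr_ge0 => i _; rewrite sqr_ge0.
Qed.

Lemma dyadic_sum (F : nat -> nat) k J : (k <= J)%N ->
  (\sum_(2 ^ k <= b < 2 ^ J) F b =
   \sum_(k <= j < J) \sum_(2 ^ j <= b < (2 ^ j).*2) F b)%N.
Proof.
elim: J => [|J IH]; first by rewrite leqn0 => /eqP ->; rewrite !big_geq.
rewrite leq_eqVlt => /orP[/eqP ->|kJ]; first by rewrite !big_geq.
rewrite big_nat_recr//= -IH// -mul2n -expnS -big_cat_nat//.
- by rewrite leq_exp2l.
- by rewrite leq_exp2l.
Qed.

Section block.
Variables (R : realType) (J : nat).
Local Notation I := 'I_(2 ^ J).

(** Quadruples are grouped as [((a, a'), (b, b'))], because the fractions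
    [a / a'] and [b / b'] are what is counted. *)
Definition close_quads (B : nat) (X D : R) : {pred (I * I) * (I * I)} :=
  [pred t : (I * I) * (I * I) | close B X D t.1.1 t.2.1 t.1.2 t.2.2].

(** Expanding the square, a pair of monomials in [(x, x + D]] is close in the
    sense of [close]; of the two memberships only that of the first monomial is
    kept, which is an indicator of an interval of length [D] in the variable
    [x]. *)
Lemma block_sqr_le (B : nat) (X D x : R) :
  (B.*2 <= 2 ^ J)%N -> 0 < X -> X <= x <= 2 * X -> 0 <= D <= 4 * X ->
  (\sum_(B <= b < B.*2) root_count_itv (2 ^ J) b x (x + D))%:R ^+ 2 <=
  \sum_(t in close_quads B X D)
     \1_(`[(t.1.1 ^ 2 * t.2.1 ^ 3)%:R - D, (t.1.1 ^ 2 * t.2.1 ^ 3)%:R[%classic : set R) x :> R.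
Proof.
move=> BJ X0 /andP[Xx x2X] /andP[D0 D4X].
pose W := [pred p : I * I | (B <= p.2 < B.*2)%N && (x < (p.1 ^ 2 * p.2 ^ 3)%:R <= x + D)].
have -> : (\sum_(B <= b < B.*2) root_count_itv (2 ^ J) b x (x + D) = #|W|)%N.
  rewrite -sum1_card (big_nat_widen _ _ _ _ _ BJ) /=.
  rewrite (big_nat_widenl _ 0%N)//= big_mkord.
  rewrite (eq_bigr (fun b : I => \sum_(a : I | (x < (a ^ 2 * b ^ 3)%:R <= x + D)%R) 1)%N); last first.
    by move=> b _; rewrite sum1_card.
  rewrite pair_big_dep /=.
  rewrite (reindex (fun p : I * I => (p.2, p.1))) /=; last first.
    by exists (fun p => (p.2, p.1)) => -[].
  by apply: eq_bigl => -[a b]; rewrite !inE /= [(_ < _)%N && _]andbC.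
under eq_bigr do rewrite indicE mem_setE in_itv.
rewrite -natrX -mulnn -cardX -natr_sum ler_nat -sum1_card.
rewrite [leqRHS](reindex (fun w : (I * I) * (I * I) => ((w.1.1, w.2.1), (w.1.2, w.2.2)))) /=; last first.
  by exists (fun w => ((w.1.1, w.2.1), (w.1.2, w.2.2))) => -[[? ?] [? ?]].
rewrite big_mkcond [leqRHS]big_mkcond; apply: leq_sum => -[[a b] [a' b']] _.
case: ifP => //; rewrite !inE /= => /andP[/andP[bB /andP[n1 n2]] /andP[bB' /andP[n1' n2']]].
rewrite ifT; first by rewrite n1 lerBlDr n2.
rewrite /close bB bB' !(le_lt_trans Xx)//=.
have h n : n%:R <= x + D -> n%:R <= 6 * X :> R by move=> nx; lra.
by rewrite !h// ler_norml; apply/andP; split; lra.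
Qed.

End block.

Arguments close_quads {R} J B X D.

(** * Integration *)

Lemma integral_le_indic (R : realType) (f : R -> R) (X D c m : R) (s : seq R) :
  0 <= X -> 0 <= D -> 0 <= c -> 0 <= m ->
  measurable_fun `[X, 2 * X]%classic f ->
  (forall x, X <= x <= 2 * X ->
     0 <= f x <= c + m * \sum_(r <- s) \1_(`[r - D, r[%classic : set R) x) ->
  (\int[lebesgue_measure]_(x in `[X, (2 * X)%R]) (f x)%:E
     <= (c * X + m * ((size s)%:R * D))%:E)%E.
Proof.
move=> X0 D0 c0 m0 mf fle; set A := `[X, 2 * X]%classic.
have mA : measurable A by exact: measurable_itv.
pose I r : set R := `[r - D, r[%classic.
have mI r : measurable (I r) by exact: measurable_itv.
pose e r : R -> \bar R := fun x => (\1_(I r) x)%:E.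
have me r : measurable_fun A (e r).
  by apply/measurable_EFinP; exact: measurable_indic.
have e0 r x : (0 <= e r x)%E by rewrite lee_fin.
pose es : R -> \bar R := fun x => (\sum_(r <- s) e r x)%E.
have mes : measurable_fun A es by exact: emeasurable_sum.
have es0 x : (0 <= es x)%E by exact: sume_ge0.
have cA : lebesgue_measure A = X%:E.
  rewrite lebesgue_measure_itv /= lte_fin; case: ltP => h.
    by rewrite -EFinB; congr EFin; ring.
  by congr EFin; lra.
apply: le_trans (_ : (\int[lebesgue_measure]_(x in A)
    (c%:E + m%:E * es x) <= _))%E.
  apply: ge0_le_integral => //.
  - by move=> x; rewrite /A /= in_itv /= lee_fin => /fle/andP[].
  - exact/measurable_EFinP.
  - by apply: emeasurable_funD => //; exact: measurable_funeM.
  - move=> x; rewrite /A /= in_itv /= => /fle/andP[_ h].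
    by rewrite /es sumEFin -EFinM -EFinD lee_fin.
rewrite ge0_integralD//; last 2 first.
- by move=> x _; rewrite mule_ge0// lee_fin.
- exact: measurable_funeM.
rewrite integral_cst//= ge0_integralZl_EFin// ge0_integral_sum//.
rewrite EFinD EFinM cA leeD2l// EFinM lee_wpmul2l ?lee_fin//.
apply: le_trans (_ : (\sum_(r <- s) D%:E <= _))%E; last first.
  by rewrite sumEFin lee_fin big_const_seq count_predT iter_addr_0 mulr_natl.
apply: lee_sum => r _; rewrite integral_indic; [|exact: mA|exact: mI].
apply: le_trans (_ : (lebesgue_measure (I r) <= _))%E.
  apply: le_measure; rewrite ?inE; last exact: subIsetl.
    exact: (measurableI _ _ (mI r) mA).
  exact: (mI r).
rewrite lebesgue_measure_itv /= lte_fin; case: ltP => h; last by rewrite lee_fin.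
by rewrite -EFinB lee_fin; lra.
Qed.

Lemma measurable_deviation (R : realType) (A : set R) (H c : R) :
  measurable A -> 0 <= H ->
  measurable_fun A (fun x : R => `| (squarefull_count (x + interval_length H x))%:R
      - (squarefull_count x)%:R - c * H | ^+ 2 : R).
Proof.
move=> mA H0.
have ndQ : {homo (fun x : R => (squarefull_count x)%:R : R) : x y / x <= y}.
  move=> x y xy; rewrite ler_nat /squarefull_count -!sum1_count.
  rewrite -(subnKC (le_truncn xy)) iotaD big_cat /=; exact: leq_addr.
apply: measurable_funX; apply: measurableT_comp => //.
apply: measurable_funB; last exact: measurable_cst.
apply: measurable_funB; apply: nondecreasing_measurable => //.
move=> x y xy; apply: ndQ; rewrite lerD// lerD2r ler_wpM2r// ler_wpM2l//.
exact: ler_wsqrtr.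
Qed.

(** With [A ^ 2 * B ^ 3 = 6 * X] one has [(A * B) ^ 2 = 6 * X / B], and the choice of
    [z] gives [H ^ 2 / B <= H ^ 2 / z <= z ^ 2]. *)
Lemma card_close_quads_le (R : realType) (J B z : nat) (X H : R) :
  0 < X -> 0 <= H -> (0 < z)%N -> (z <= B)%N -> H ^+ 2 <= z%:R ^+ 3 ->
  4 * Num.sqrt X * H / X * #|close_quads J B X (4 * Num.sqrt X * H)|%:R
    <= 226 * J%:R ^+ 2 * (12 * z%:R) ^+ 2.
Proof.
move=> X0 H0 z0 zB Hz; have B0 := leq_trans z0 zB.
have rz1 : 1 <= z%:R :> R by rewrite ler1n.
have rB0 : 0 < B%:R :> R by rewrite ltr0n.
have s0 : 0 < Num.sqrt X by rewrite sqrtr_gt0.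
have s2 : Num.sqrt X ^+ 2 = X by rewrite sqr_sqrtr// ltW.
set D := 4 * Num.sqrt X * H; have D0 : 0 <= D by rewrite !mulr_ge0// ltW.
pose A := Num.sqrt (6 * X / B%:R ^+ 3).
have A2 : A ^+ 2 = 6 * X / B%:R ^+ 3.
  by rewrite sqr_sqrtr// divr_ge0 ?mulr_ge0 ?exprn_ge0 ?(ltW X0) ?(ltW rB0).
have A0 : 0 < A by rewrite sqrtr_gt0 divr_gt0 ?exprn_gt0// mulr_gt0.
have AX : A ^+ 2 * B%:R ^+ 3 = 6 * X by rewrite A2 divfK// expf_neq0// gt_eqF.
(* [D * P / X] is of size [z] because [H * P <= 3 * sqrt X * z]. *)
pose P := A * B%:R; have P0 : 0 <= P by rewrite mulr_ge0 ?ltW.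
have HP : H * P <= 3 * Num.sqrt X * z%:R.
  have nn : 0 <= 3 * Num.sqrt X * z%:R by rewrite !mulr_ge0// ltW.
  rewrite -(@ler_pXn2r _ 2)// ?nnegrE ?(mulr_ge0 H0 P0)//.
  have -> : (3 * Num.sqrt X * z%:R) ^+ 2 = 9 * X * z%:R ^+ 2.
    by rewrite !exprMn s2; ring.
  have -> : (H * P) ^+ 2 = H ^+ 2 / B%:R * (6 * X).
    by rewrite /P !exprMn A2; field; rewrite gt_eqF.
  have -> : 9 * X * z%:R ^+ 2 = z%:R ^+ 2 * (9 * X) by ring.
  have HB : H ^+ 2 / B%:R <= z%:R ^+ 2.
    rewrite ler_pdivrMr//; apply: le_trans Hz _.
    by rewrite (exprSr _ 2) ler_wpM2l ?sqr_ge0// ler_nat.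
  apply: ler_pM => //; last by lra.
    by rewrite divr_ge0 ?sqr_ge0 ?(ltW rB0).
  by rewrite mulr_ge0// ltW.
have DP : D / X * P <= 12 * z%:R.
  rewrite mulrAC ler_pdivrMr//; have -> : D * P = 4 * Num.sqrt X * (H * P) by rewrite /D; ring.
  apply: le_trans (ler_wpM2l _ HP) _; first by rewrite mulr_ge0// ltW.
  by rewrite -[X in _ <= _ * X]s2; lra.
have DP0 : 0 <= D / X * P by rewrite mulr_ge0// divr_ge0// ltW.
have := card_close J X0 D0 B0 A0 AX; set N := #|_|%:R => cN.
have DX0 : 0 <= D / X by rewrite divr_ge0// ltW.
apply: le_trans (ler_wpM2l DX0 cN) _.
have -> : D / X * (J%:R ^+ 2 * (A * (2 * B%:R) + 56 * (D / X) * (A * (2 * B%:R)) ^+ 2)) =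
  J%:R ^+ 2 * (2 * (D / X * P) + 224 * (D / X * P) ^+ 2) by rewrite /P; ring.
have -> : 226 * J%:R ^+ 2 * (12 * z%:R) ^+ 2 = J%:R ^+ 2 * (226 * (12 * z%:R) ^+ 2) :> R by ring.
rewrite ler_wpM2l ?sqr_ge0//.
have : (D / X * P) ^+ 2 <= (12 * z%:R) ^+ 2.
  by rewrite lerXn2r ?nnegrE// mulr_ge0.
have : 12 * z%:R <= (12 * z%:R) ^+ 2 :> R by rewrite expr2 ler_peMl ?mulr_ge0//; lra.
by lra.
Qed.

(** The power [8 ^ k] is the cube of [z = 2 ^ k], so that [z ^ 3] is within a
    factor [8] of [H ^ 2]; this balances the error [z] of the terms [b < z]
    against the tail [H / sqrt z]. The bound [2 ^ J] exceeds every [a] and [b]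
    in play, and the number [J] of dyadic blocks plays the role of [log X]. *)
Lemma variance_le (R : realType) (X H : R) (J k : nat) :
  1 < X -> 1 <= H -> H ^+ 2 <= X ->
  H ^+ 2 <= (8 ^ k)%:R <= 8 * H ^+ 2 -> 8 * X <= (2 ^ J)%:R ->
  ((X^-1)%:E *
     \int[lebesgue_measure]_(x in `[X, (2 * X)%R])
       (`| (squarefull_count (x + interval_length H x))%:R
           - (squarefull_count x)%:R - zeta (3 / 2) / zeta 3 * H | ^+ 2)%R%:E
   <= (453 * J%:R ^+ 4 * (12 * (2 ^ k)%:R) ^+ 2)%R%:E)%E.
Proof.
move=> X1 H1 HX /andP[Hk kH] XJ.
have X0 : 0 < X by lra.
have H0 : 0 < H by lra.
set z := (2 ^ k)%N; have z0 : (0 < z)%N by rewrite expn_gt0.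
have z1 : 1 <= z%:R :> R by rewrite ler1n.
have z3 : (8 ^ k)%:R = z%:R ^+ 3 :> R by rewrite -natrX -expnM mulnC expnM.
rewrite z3 in Hk kH.
have s0 : 0 < Num.sqrt X by rewrite sqrtr_gt0.
have s2 : Num.sqrt X ^+ 2 = X by rewrite sqr_sqrtr// ltW.
have Hs : H <= Num.sqrt X.
  by rewrite -(@ler_pXn2r _ 2)// ?nnegrE ?s2 ?(ltW s0) ?(ltW H0).
have zJ : (z <= 2 ^ J)%N.
  by rewrite -(ler_nat R); have : z%:R <= z%:R ^+ 3 :> R; [exact: ler_eXnr | lra].
have kJ : (k <= J)%N by rewrite -(@leq_exp2l 2).
have J1 : 1 <= J%:R :> R.
  by rewrite ler1n; case: (J) XJ => //; rewrite expn0; lra.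
set D := 4 * Num.sqrt X * H.
have D0 : 0 <= D by rewrite !mulr_ge0// ltW.
have D4X : D <= 4 * X by rewrite /D -[X in _ <= _ * X]s2 expr2 mulrA ler_wpM2l// mulr_ge0// ltW.
have Hz : H / Num.sqrt z%:R <= z%:R.
  rewrite ler_pdivrMr ?sqrtr_gt0 ?ltr0n//.
  rewrite -(@ler_pXn2r _ 2)// ?nnegrE ?(ltW H0) ?mulr_ge0 ?sqrtr_ge0//.
  by rewrite exprMn sqr_sqrtr// -exprSr.
pose n (t : ('I_(2 ^ J) * 'I_(2 ^ J)) * ('I_(2 ^ J) * 'I_(2 ^ J))) : R :=
  (t.1.1 ^ 2 * t.2.1 ^ 3)%:R.
(* One right endpoint for each close quadruple, over all the blocks. *)
pose s := flatten [seq [seq n t | t <- enum (close_quads J (2 ^ j) X D)] | j <- index_iota k J].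
have sumE (F : R -> R) : \sum_(r <- s) F r =
    \sum_(k <= j < J) \sum_(t in close_quads J (2 ^ j) X D) F (n t).
  rewrite big_flatten big_map; apply: eq_bigr => j _.
  by rewrite big_map big_enum.
have pointwise x : X <= x <= 2 * X ->
   `| (squarefull_count (x + interval_length H x))%:R
           - (squarefull_count x)%:R - zeta (3 / 2) / zeta 3 * H | ^+ 2 <=
   50 * z%:R ^+ 2 + 2 * J%:R * \sum_(r <- s) \1_(`[r - D, r[%classic : set R) x.
  move=> /[dup] xX /andP[Xx x2X].
  have x0 : 0 <= x by lra.
  (* For [x <= 2 * X] the length is at most [3 * sqrt X * H + H ^ 2]. *)
  have lenD : interval_length H x <= D.
    have sx : Num.sqrt x <= 3 / 2 * Num.sqrt X.
      rewrite -(@ler_pXn2r _ 2)// ?nnegrE ?sqrtr_ge0 ?mulr_ge0 ?(ltW s0)//.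
      by rewrite exprMn sqr_sqrtr// s2; lra.
    rewrite /interval_length /D.
    have h1 : Num.sqrt x * H <= 3 / 2 * Num.sqrt X * H by rewrite ler_wpM2r// ltW.
    have h2 : H ^+ 2 <= Num.sqrt X * H by rewrite expr2 ler_wpM2r// ltW.
    lra.
  have xK : x + interval_length H x < (2 ^ J)%:R by lra.
  have dev := deviation_le x0 (ltW H0) xK z0 zJ.
  set S := (\sum_(z <= b < 2 ^ J) root_count_itv (2 ^ J) b x (x + D))%N.
  have devS : `| (squarefull_count (x + interval_length H x))%:R
           - (squarefull_count x)%:R - zeta (3 / 2) / zeta 3 * H | <= 5 * z%:R + S%:R.
    apply: le_trans dev _; rewrite lerD//; last first.
      rewrite ler_nat; apply: leq_sum => b _; apply: subset_leq_card.
      apply/fintype.subsetP => a; rewrite !inE => /andP[-> h] /=.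
      by apply: le_trans h _; rewrite lerD2l.
    by rewrite mulrCA; lra.
  apply: le_trans (_ : (5 * z%:R + S%:R) ^+ 2 <= _).
    by rewrite lerXn2r ?nnegrE// addr_ge0 ?mulr_ge0.
  have : S%:R ^+ 2 <= J%:R * \sum_(r <- s) \1_(`[r - D, r[%classic : set R) x :> R.
    rewrite /S dyadic_sum// natr_sum (le_trans (sqr_sum_le _ kJ))// ler_wpM2l// sumE.
    rewrite big_nat_cond [leRHS]big_nat_cond; apply: ler_sum => j /andP[/andP[kj jJ] _].
    apply: block_sqr_le => //; last by rewrite D0.
    by rewrite -mul2n -expnS leq_exp2l.
  have := sqr_ge0 (5 * z%:R - S%:R : R).
  rewrite sqrrB sqrrD; set T := \sum_(r <- s) _; nra.
have mf := @measurable_deviation R `[X, 2 * X]%classic H (zeta (3 / 2) / zeta 3)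
   (measurable_itv _) (ltW H0).
have c0 : 0 <= 50 * z%:R ^+ 2 :> R by rewrite mulr_ge0 ?sqr_ge0.
have m0 : 0 <= 2 * J%:R :> R by rewrite mulr_ge0.
have bound := integral_le_indic (ltW X0) D0 c0 m0 mf
  (fun x xX => introT andP (conj (sqr_ge0 _) (pointwise x xX))).
apply: le_trans (lee_wpmul2l _ bound) _; first by rewrite lee_fin invr_ge0 ltW.
rewrite -EFinM lee_fin.
have sz : (size s)%:R * (D / X) <= J%:R * (226 * J%:R ^+ 2 * (12 * z%:R) ^+ 2).
  have -> : (size s)%:R = \sum_(r <- s) 1 :> R by rewrite big_const_seq count_predT iter_addr_0.
  rewrite sumE mulr_suml.
  apply: le_trans (_ : \sum_(k <= j < J) (226 * J%:R ^+ 2 * (12 * z%:R) ^+ 2) <= _).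
    rewrite big_nat_cond [leRHS]big_nat_cond; apply: ler_sum => j /andP[/andP[kj jJ] _].
    rewrite sumr_const mulrC; apply: card_close_quads_le => //; first exact: ltW.
    by rewrite leq_exp2l.
  by rewrite sumr_const_nat -(mulr_natl (_ * _)) ler_wpM2r ?ler_nat ?leq_subr.
have -> : X^-1 * (50 * z%:R ^+ 2 * X + 2 * J%:R * ((size s)%:R * D)) =
   50 * z%:R ^+ 2 + 2 * J%:R * ((size s)%:R * (D / X)) by field; rewrite gt_eqF.
apply: le_trans (_ : 50 * z%:R ^+ 2 + 2 * J%:R * (J%:R * (226 * J%:R ^+ 2 * (12 * z%:R) ^+ 2)) <= _).
  by rewrite lerD2l ler_wpM2l// mulr_ge0.
have J4 : (12 * z%:R) ^+ 2 <= J%:R ^+ 4 * (12 * z%:R) ^+ 2 :> R.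
  by rewrite ler_peMl ?sqr_ge0// exprn_ege1.
have -> : 2 * J%:R * (J%:R * (226 * J%:R ^+ 2 * (12 * z%:R) ^+ 2)) =
  452 * (J%:R ^+ 4 * (12 * z%:R) ^+ 2) :> R by ring.
have : 50 * z%:R ^+ 2 <= (12 * z%:R) ^+ 2 :> R.
  by rewrite exprMn ler_wpM2r ?sqr_ge0//; lra.
lra.
Qed.

(** * The mean square in terms of [H] *)

Lemma exists_pow_near (R : realType) (r : nat) (M : R) : (1 < r)%N -> 1 <= M ->
  exists j, M <= (r ^ j)%:R <= r%:R * M.
Proof.
move=> r1 M1; have M0 : 0 <= M by lra.
have ex : exists j, M <= (r ^ j)%:R.
  exists (Num.truncn M).+1; have /andP[_ h] := truncn_itv M0.
  by apply: le_trans (ltW h) _; rewrite ler_nat ltnW// ltn_expl.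
case: (ex_minnP ex) => j Mj jmin; exists j; rewrite Mj /=.
case: j jmin {Mj} => [_|j jmin].
  rewrite expn0; have : 1 <= r%:R :> R by rewrite ler1n ltnW.
  by move=> r1'; apply: le_trans M1 _; rewrite ler_peMl.
rewrite expnS natrM ler_wpM2l// leNgt; apply/negP => /ltW /jmin.
by rewrite ltnn.
Qed.

(** Taking [u = e * J * ln 2] in [1 + u <= expR u] bounds a logarithm by an
    arbitrarily small power. *)
Lemma log2_le_powR (R : realType) (J : nat) (e : R) : 0 < e ->
  J%:R <= ((2 ^ J)%:R `^ e) / (e * ln 2) :> R.
Proof.
move=> e0; have l2 : 0 < ln (2 : R) by rewrite ln_gt0// ltr1n.
rewrite ler_pdivlMr ?mulr_gt0// natrX.
have -> : (2 ^+ J : R) `^ e = expR (J%:R * (e * ln 2)).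
  rewrite /powR expf_eq0 pnatr_eq0 andbF lnXn// -mulr_natl; congr expR; ring.
by apply: le_trans (expR_ge1Dx _); rewrite lerDr.
Qed.

Theorem theorem1 (R : realType) (eps : R) (eps_gt0 : 0 < eps) :
  exists2 C : R, 0 < C &
    forall X H : R, 1 < X ->
      X `^ (3 * eps) <= H -> H <= X `^ (1 / 2 - eps) ->
      ((X^-1)%:E *
         \int[lebesgue_measure]_(x in `[X, (2 * X)%R])
           (`| (squarefull_count (x + interval_length H x))%:R
               - (squarefull_count x)%:R
               - zeta (3 / 2) / zeta 3 * H | ^+ 2)%R%:E
       <= (C * H `^ (16 / 11 + eps))%R%:E)%E.
Proof.
(* [J ^ 4] costs [X ^ (4 * d) = X ^ (3 * eps * eps) <= H ^ eps]. *)
pose d := 3 * eps * eps / 4.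
have d0 : 0 < d by rewrite divr_gt0// !mulr_gt0.
have l2 : 0 < ln (2 : R) by rewrite ln_gt0// ltr1n.
pose c := 16 `^ d / (d * ln 2).
have c0 : 0 < c by rewrite divr_gt0 ?powR_gt0// mulr_gt0.
exists (453 * (24 ^+ 2 * c ^+ 4)) => [|X H X1 XH HX].
  by apply: mulr_gt0; [exact: ltr0Sn|apply: mulr_gt0; exact: exprn_gt0].
have X0 : 0 < X by lra.
have H1 : 1 <= H.
  by apply: le_trans XH; rewrite -[leLHS](powRr0 X) ler_powR ?(ltW X1)// !mulr_ge0// ltW.
have H0 : 0 < H by lra.
have HX2 : H ^+ 2 <= X.
  have -> : X = (X `^ (1 / 2)) ^+ 2.
    by rewrite -powR_mulrn ?powR_ge0// -powRrM divfK// powRr1// ltW.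
  rewrite lerXn2r ?nnegrE ?powR_ge0 ?(ltW H0)//; apply: le_trans HX _.
  by rewrite ler_powR ?(ltW X1)//; lra.
have H21 : 1 <= H ^+ 2 by rewrite exprn_ege1.
have [k /[dup] kH /andP[_ kH2]] := @exists_pow_near R 8 (H ^+ 2) isT H21.
have X81 : 1 <= 8 * X by lra.
have [J /andP[JX JX2]] := @exists_pow_near R 2 (8 * X) isT X81.
apply: le_trans (variance_le X1 H1 HX2 kH JX) _; rewrite lee_fin.
have z2 : (2 ^ k)%:R <= 2 * H `^ (2 / 3) :> R.
  rewrite -(@ler_pXn2r _ 3)// ?nnegrE ?mulr_ge0 ?powR_ge0//.
  rewrite -natrX -expnM mulnC expnM; apply: le_trans kH2 _.
  rewrite exprMn -[X in _ <= _ * X]powR_mulrn ?powR_ge0// -powRrM divfK//.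
  by rewrite powR_mulrn ?(ltW H0)//; lra.
have H43 : (12 * (2 ^ k)%:R) ^+ 2 <= 24 ^+ 2 * H `^ (16 / 11).
  apply: le_trans (_ : (24 * H `^ (2 / 3)) ^+ 2 <= _).
    have p0 : 0 <= H `^ (2 / 3) := powR_ge0 _ _.
    have : 0 <= (2 ^ k)%:R :> R by [].
    by move=> z0; apply: lerXn2r; rewrite ?nnegrE; lra.
  rewrite exprMn -[X in _ * X]powR_mulrn ?powR_ge0// -powRrM.
  by rewrite ler_wpM2l// ler_powR//; lra.
have Jc : J%:R <= c * X `^ d.
  apply: le_trans (log2_le_powR J d0) _.
  rewrite /c [leRHS]mulrAC ler_wpM2r//; first by rewrite invr_ge0 ltW// mulr_gt0.
  rewrite -powRM ?(ltW X0)//; apply: ge0_ler_powR; rewrite ?nnegrE ?(ltW d0)//; lra.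
have J4 : J%:R ^+ 4 <= c ^+ 4 * H `^ eps.
  apply: le_trans (_ : (c * X `^ d) ^+ 4 <= _).
    have : 0 <= c * X `^ d by rewrite mulr_ge0 ?powR_ge0// ltW.
    by move=> cX0; rewrite lerXn2r ?nnegrE.
  rewrite exprMn ler_wpM2l ?exprn_ge0 ?(ltW c0)//.
  rewrite -powR_mulrn ?powR_ge0// -powRrM /d divfK// powRrM.
  by rewrite ge0_ler_powR ?(ltW eps_gt0) ?nnegrE ?powR_ge0 ?(ltW H0).
rewrite powRD; last by rewrite (gt_eqF H0) implybT.
have -> : 453 * (24 ^+ 2 * c ^+ 4) * (H `^ (16 / 11) * H `^ eps) =
  453 * (c ^+ 4 * H `^ eps) * (24 ^+ 2 * H `^ (16 / 11)) by ring.
apply: ler_pM; [|exact: sqr_ge0| |exact: H43].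
  by apply: mulr_ge0; [exact: ler0n|apply: exprn_ge0].
by apply: ler_wpM2l; [exact: ler0n|exact: J4].
Qed.
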